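(* Let $\Bbbk$ be a commutative ring, let $(\mathcal{C},\boxtimes,\mathbb{I},\mathfrak{a},\mathfrak{l},\mathfrak{r})$ be an essentially small right rigid monoidal category with chosen right duals $(X^\star,\mathsf{ev}_X,\mathsf{db}_X)$, and let $(F,\varphi,\varphi_0)$, $F:\mathcal{C}\to\mathfrak{M}_f$, be a neutral quasi-monoidal functor to finitely generated projective $\Bbbk$-modules, with coendomorphism coquasi-bialgebra $H$ and natural coaction $\delta_X:F(X)\to H\otimes F(X)$. Assume that there is a natural isomorphism $\nu_X:F(X^\star)\to F(X)^*=\mathrm{Hom}_\Bbbk(F(X),\Bbbk)$ in $\mathfrak{M}_f$. Endow $F(X)^*$ with the $H$-coaction $\delta_{X^*}:=(H\otimes\nu_X)\,\delta_{X^\star}\,\nu_X^{-1}$. Then $F(X)^*$ is a right dual of $F(X)$ in the monoidal category of left $H$-comodules that are finitely generated projective over $\Bbbk$, with evaluation and dual basis maps $$\mathsf{ev}^{( * )}_{F(X)}=\mathsf{ev}_{F(X)}(F(X)\otimes\nu_X^{-1}),\qquad\mathsf{db}^{( * )}_{F(X)}=(\nu_X\otimes F(X))\,\mathsf{db}_{F(X)},$$ where $\mathsf{ev}_{F(X)}=\varphi_0^{-1}F(\mathsf{ev}_X)\varphi_{X,X^\star}$ and $\mathsf{db}_{F(X)}=\varphi_{X^\star,X}^{-1}F(\mathsf{db}_X)\varphi_0$. Let $\mathsf{ev}^{(\Bbbk)}_V:V\otimes V^*\to\Bbbk$ and $\mathsf{db}^{(\Bbbk)}_V:\Bbbk\to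 V^*\otimes V$ denote the ordinary evaluation and dual basis maps of a finitely generated projective $\Bbbk$-module $V$. There exist unique linear maps $\alpha,\beta\in H^*$ and $s:H\to H$ such that, for all $X$ in $\mathcal{C}$, $$(\alpha\otimes F(X))\delta_X=(\mathsf{ev}^{(\Bbbk)}_{F(X)}\otimes F(X))(F(X)\otimes\mathsf{db}^{( * )}_{F(X)}),$$ $$(\beta\otimes F(X))\delta_X=(\mathsf{ev}^{( * )}_{F(X)}\otimes F(X))(F(X)\otimes\mathsf{db}^{(\Bbbk)}_{F(X)}),$$ $$(s\otimes F(X))\delta_X=(H\otimes\mathsf{ev}^{(\Bbbk)}_{F(X)}\otimes F(X))(\tau_{F(X),H}\otimes F(X)^*\otimes F(X))(F(X)\otimes\delta_{X^*}\otimes F(X))(F(X)\otimes\mathsf{db}^{(\Bbbk)}_{F(X)}),$$ and $(s,\alpha,\beta)$ is a coquasi-antipode for $H$, so that $H$ is a coquasi-Hopf algebra. Moreover, writing $\mathsf{db}^{(\Bbbk)}_{F(X)}(1)=\sum_i e^i\otimes e_i$ and $\delta_X(x)=\sum x_{-1}\otimes x_0$, for all $x\in F(X)$ and $f\in F(X)^*$ one has $$\delta_{X^*}(f)=\sum_i s((e_i)_{-1})\,f((e_i)_0)\otimes e^i,\qquad\mathsf{db}^{( * )}_{F(X)}(1)=\sum_i e^i\otimes\alpha((e_i)_{-1})(e_i)_0,\qquad\mathsf{ev}^{( * )}_{F(X)}(x\otimes f)=\sum\beta(x_{-1})f(x_0).$$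
   Context: Conventions: $\Bbbk$ is a commutative ring, $\otimes=\otimes_\Bbbk$, $\mathfrak{M}$ is the monoidal category of $\Bbbk$-modules (its constraints are suppressed), $\mathfrak{M}_f$ its full subcategory of finitely generated projective modules. Sweedler notation: $\Delta(h)=\sum h_1\otimes h_2$; left coactions $\rho(v)=\sum v_{-1}\otimes v_0$. The flip is $\tau_{V,W}(v\otimes w)=w\otimes v$. Quasi-monoidal functor: a functor $F:\mathcal{C}\to\mathfrak{M}_f$ with an isomorphism $\varphi_0:\Bbbk\to F(\mathbb{I})$ and a natural isomorphism $\varphi_{X,Y}:F(X)\otimes F(Y)\to F(X\boxtimes Y)$ (no compatibility with the associativity constraints is required). It is neutral if $F(\mathfrak{l}_X)\varphi_{\mathbb{I},X}(\varphi_0\otimes F(X))$ and $F(\mathfrak{r}_X)\varphi_{X,\mathbb{I}}(F(X)\otimes\varphi_0)$ are the canonical isomorphisms $\Bbbk\otimes F(X)\cong F(X)$ and $F(X)\otimes\Bbbk\cong F(X)$, for all $X$. Right rigid: here $\mathfrak{a}_{X,Y,Z}:(X\boxtimes Y)\boxtimes Z\to X\boxtimes(Y\boxtimes Z)$. A right dual of $X$ is an object $X^\star$ with morphisms $\mathsf{ev}_X:X\boxtimes X^\star\to\mathbb{I}$, $\mathsf{db}_X:\mathbb{I}\to X^\star\boxtimes X$ such that (unit constraints suppressed) $(\mathsf{ev}_X\boxtimes X)\,\mathfrak{a}^{-1}_{X,X^\star,X}\,(X\boxtimes\mathsf{db}_X)=\mathrm{id}_X$ and $(X^\star\boxtimes\mathsf{ev}_X)\,\mathfrak{a}_{X^\star,X,X^\star}\,(\mathsf{db}_X\boxtimes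 X^\star)=\mathrm{id}_{X^\star}$. $\mathcal{C}$ is right rigid if every object has a right dual. Then $(-)^\star$ is a functor $\mathcal{C}^{\mathrm{op}}\to\mathcal{C}$, with $f^\star$ determined by $\mathsf{ev}_X(X\boxtimes f^\star)=\mathsf{ev}_Y(f\boxtimes Y^\star)$ for $f:X\to Y$; naturality of $\nu$ refers to this functor and to the linear transpose. Coquasi-bialgebra: a coassociative counital $\Bbbk$-coalgebra $(H,\Delta,\varepsilon)$ with coalgebra maps $m:H\otimes H\to H$ (written $ab$), $u:\Bbbk\to H$ ($1_H=u(1)$) and a convolution invertible linear map $\omega:H\otimes H\otimes H\to\Bbbk$ (reassociator) such that, for all $a,b,c,d\in H$: $\sum\omega(a_1\otimes b_1\otimes c_1d_1)\,\omega(a_2b_2\otimes c_2\otimes d_2)=\sum\omega(b_1\otimes c_1\otimes d_1)\,\omega(a_1\otimes b_2c_2\otimes d_2)\,\omega(a_2\otimes b_3\otimes c_3)$; $\omega(a\otimes 1_H\otimes b)=\varepsilon(a)\varepsilon(b)$; $1_Ha=a=a1_H$; $\sum a_1(b_1c_1)\,\omega(a_2\otimes b_2\otimes c_2)=\sum\omega(a_1\otimes b_1\otimes c_1)\,(a_2b_2)c_2$. Monoidal structure on left $H$-comodules: $V\otimes W$ has coaction $v\otimes w\mapsto\sum v_{-1}w_{-1}\otimes v_0\otimes w_0$; the unit is $\Bbbk$ with coaction $k\mapsto 1_H\otimes k$; the associativity constraint is $(u\otimes v)\otimes w\mapsto\sum\omega^{-1}(u_{-1}\otimes v_{-1}\otimes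 w_{-1})\,u_0\otimes(v_0\otimes w_0)$; the unit constraints are the canonical ones. Coquasi-Hopf algebra: a coquasi-bialgebra $H$ with a coquasi-antipode, i.e. a triple $(s,\alpha,\beta)$ with $s:H\to H$ an anti-coalgebra endomorphism and $\alpha,\beta\in H^*$ such that, for all $h\in H$: $\sum h_1\beta(h_2)s(h_3)=\beta(h)1_H$; $\sum s(h_1)\alpha(h_2)h_3=\alpha(h)1_H$; $\sum\omega(h_1\otimes\beta(h_2)s(h_3)\alpha(h_4)\otimes h_5)=\varepsilon(h)$; $\sum\omega^{-1}(s(h_1)\otimes\alpha(h_2)h_3\beta(h_4)\otimes s(h_5))=\varepsilon(h)$. Coendomorphism coquasi-bialgebra $H$ of $(\mathcal{C},F)$: as a $\Bbbk$-module $H$ is the coend of $F\otimes F^*:\mathcal{C}\times\mathcal{C}^{\mathrm{op}}\to\mathfrak{M}$, i.e. the quotient of $\bigoplus_X F(X)\otimes F(X)^*$ by the relations $x\otimes(\psi\circ F(f))=F(f)(x)\otimes\psi$ for $f:X\to Y$, $x\in F(X)$, $\psi\in F(Y)^*$. It carries the natural transformation $\delta_X:F(X)\to H\otimes F(X)$, $\delta_X(x)=\sum x_{-1}\otimes x_0:=\sum_i[x\otimes e^i]\otimes e_i$ with $\sum_i e^i\otimes e_i\in F(X)^*\otimes F(X)$ a dual basis. For every $n\ge1$ and every $\Bbbk$-module $V$, sending $f\in\mathrm{Hom}_\Bbbk(H^{\otimes n},V)$ to the natural transformation $x_1\otimes\cdots\otimes x_n\mapsto\sum f((x_1)_{-1}\otimes\cdots\otimes(x_n)_{-1})\otimes(x_1)_0\otimes\cdots\otimes(x_n)_0$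 is a bijection onto the natural transformations $F(X_1)\otimes\cdots\otimes F(X_n)\to V\otimes F(X_1)\otimes\cdots\otimes F(X_n)$ (natural in $(X_1,\dots,X_n)\in\mathcal{C}^n$). The structure maps of $H$ are the unique linear maps satisfying, for all $X,Y,Z$ and $x\in F(X),y\in F(Y),z\in F(Z)$: $(\Delta\otimes F(X))\delta_X=(H\otimes\delta_X)\delta_X$; $(\varepsilon\otimes F(X))\delta_X=\mathrm{id}$; $\sum x_{-1}y_{-1}\otimes\varphi_{X,Y}(x_0\otimes y_0)=\delta_{X\boxtimes Y}(\varphi_{X,Y}(x\otimes y))$; $u(1)\otimes\varphi_0(1)=\delta_{\mathbb{I}}(\varphi_0(1))$; $\sum\omega(x_{-1}\otimes y_{-1}\otimes z_{-1})\,\varphi_{X\boxtimes Y,Z}(\varphi_{X,Y}(x_0\otimes y_0)\otimes z_0)=F(\mathfrak{a}_{X,Y,Z}^{-1})\,\varphi_{X,Y\boxtimes Z}(x\otimes\varphi_{Y,Z}(y\otimes z))$. By a theorem of Majid, these make $H$ a coquasi-bialgebra. *)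

(* Defs.v *)
From HB Require Import structures.
From mathcomp Require Import all_boot all_algebra.
From mathcomp Require Import boolp classical_sets.

Set Implicit Arguments.
Unset Strict Implicit.
Unset Printing Implicit Defensive.

Import GRing.Theory.
Local Open Scope quotient_scope.
Local Open Scope ring_scope.

Definition bilinear_map (k : comPzRingType) (U V W : lmodType k)
    (f : U -> V -> W) : Prop :=
  (forall v, linear (f^~ v)) /\ (forall u, linear (f u)).

Section Tensor.
Variables (k : comPzRingType) (U V : lmodType k).

Definition formal_sum (W : lmodType k) (f : U -> V -> W) (s : seq (U * V)) : W :=
  \sum_(p <- s) f p.1 p.2.

(* The tensor product of U and V is the quotient of the formal sums of pairs
   (u, v) by the equality of values under all bilinear maps; the universal
   property is tliftE, tlift_linear and tensor_ext below. *)
Definition tensor_eq (s t : seq (U * V)) : bool :=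
  `[< forall (W : lmodType k) (f : U -> V -> W), bilinear_map f ->
      formal_sum f s = formal_sum f t >].

Lemma tensor_eq_equiv : equiv_class_of tensor_eq.
Proof.
split=> [s|s t|t s r]; first exact/asboolP.
  by apply/asboolP/asboolP => h W f hf; rewrite h.
by move=> /asboolP h1 /asboolP h2; apply/asboolP => W f hf; rewrite h1 ?h2.
Qed.

Canonical tensor_eq_rel := EquivRelPack tensor_eq_equiv.

Definition tensor : Type := {eq_quot tensor_eq}.

HB.instance Definition _ := Choice.on tensor.
HB.instance Definition _ := EqQuotient.on tensor.

Definition tens (u : U) (v : V) : tensor := \pi_tensor [:: (u, v)].

(* Sweedler sums: tsum t f is the value at t of the linear map induced by f.
   It does not depend on the chosen representative when f is bilinear. *)
Definition tsum (W : lmodType k) (t : tensor) (f : U -> V -> W) : W :=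
  formal_sum f (repr t).

Lemma tsum_pi (W : lmodType k) (f : U -> V -> W) s :
  bilinear_map f -> tsum (\pi_tensor s) f = formal_sum f s.
Proof.
move=> hf; rewrite /tsum.
by case: piP => t /eqquotP /asboolP h; rewrite h.
Qed.

Lemma tsum_inj (x y : tensor) :
  (forall (W : lmodType k) (f : U -> V -> W), bilinear_map f ->
     tsum x f = tsum y f) -> x = y.
Proof.
move=> h; rewrite -[x]reprK -[y]reprK; apply/eqquotP/asboolP => W f hf.
exact: (h W f hf).
Qed.

Definition tensor_add (x y : tensor) : tensor := \pi_tensor (repr x ++ repr y).
Definition tensor_scale (a : k) (x : tensor) : tensor :=
  \pi_tensor [seq (a *: p.1, p.2) | p <- repr x].
Definition tensor_zero : tensor := \pi_tensor [::].
Definition tensor_opp : tensor -> tensor := tensor_scale (- 1).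

Lemma tsum_add (W : lmodType k) (f : U -> V -> W) x y : bilinear_map f ->
  tsum (tensor_add x y) f = tsum x f + tsum y f.
Proof. by move=> hf; rewrite tsum_pi // /formal_sum big_cat. Qed.

Lemma tsum_zero (W : lmodType k) (f : U -> V -> W) : bilinear_map f -> tsum tensor_zero f = 0.
Proof. by move=> hf; rewrite tsum_pi // /formal_sum big_nil. Qed.

Lemma tsum_scale (W : lmodType k) (f : U -> V -> W) a x : bilinear_map f ->
  tsum (tensor_scale a x) f = a *: tsum x f.
Proof.
move=> hf; rewrite tsum_pi // /tsum /formal_sum big_map scaler_sumr.
by apply: eq_bigr => p _ /=; have /= -> := scalable_linear (hf.1 p.2).
Qed.

Fact tensor_addA : associative tensor_add.
Proof. by move=> x y z; apply: tsum_inj => W f h; rewrite !tsum_add// addrA. Qed.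
Fact tensor_addC : commutative tensor_add.
Proof. by move=> x y; apply: tsum_inj => W f h; rewrite !tsum_add// addrC. Qed.
Fact tensor_add0 : left_id tensor_zero tensor_add.
Proof.
by move=> x; apply: tsum_inj => W f h; rewrite tsum_add// tsum_zero// add0r.
Qed.
Fact tensor_addN : left_inverse tensor_zero tensor_opp tensor_add.
Proof.
move=> x; apply: tsum_inj => W f h.
by rewrite tsum_add// tsum_scale// tsum_zero// scaleN1r addNr.
Qed.

HB.instance Definition _ := GRing.isZmodule.Build tensor
  tensor_addA tensor_addC tensor_add0 tensor_addN.

Fact tensor_scaleA a b x :
  tensor_scale a (tensor_scale b x) = tensor_scale (a * b) x.
Proof. by apply: tsum_inj => W f h; rewrite !tsum_scale// scalerA. Qed.
Fact tensor_scale1 : left_id 1 tensor_scale.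
Proof. by move=> x; apply: tsum_inj => W f h; rewrite tsum_scale// scale1r. Qed.
Fact tensor_scaleDr : right_distributive tensor_scale +%R.
Proof.
move=> a x y; apply: tsum_inj => W f h.
by rewrite tsum_scale// !tsum_add// !tsum_scale// scalerDr.
Qed.
Fact tensor_scaleDl x : {morph tensor_scale^~ x : a b / a + b}.
Proof.
move=> a b; apply: tsum_inj => W f h.
by rewrite tsum_add// !tsum_scale// scalerDl.
Qed.

HB.instance Definition _ := GRing.Zmodule_isLmodule.Build k tensor
  tensor_scaleA tensor_scale1 tensor_scaleDr tensor_scaleDl.

Lemma tliftE (W : lmodType k) (f : U -> V -> W) u v :
  bilinear_map f -> tsum (tens u v) f = f u v.
Proof. by move=> hf; rewrite tsum_pi // /formal_sum big_seq1. Qed.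

Lemma tlift_linear (W : lmodType k) (f : U -> V -> W) :
  bilinear_map f -> linear (fun t : tensor => tsum t f).
Proof. by move=> hf a x y; rewrite tsum_add // tsum_scale. Qed.

Lemma tens_bilinear : bilinear_map (tens : U -> V -> tensor).
Proof.
split=> [v|u] a x y /=; apply: tsum_inj => W f hf.
  by rewrite tlift_linear // !tliftE //; have /= -> := hf.1 v.
by rewrite tlift_linear // !tliftE //; have /= -> := hf.2 u.
Qed.

Lemma tensE (t : tensor) : t = \sum_(p <- repr t) tens p.1 p.2.
Proof.
by apply: tsum_inj => W f hf; rewrite -[tsum _ _]/(formal_sum _ _) /formal_sum;
  elim: (repr t) => [|p s IH]; rewrite ?big_nil ?big_cons ?tsum_zero//
  tsum_add// IH tliftE.
Qed.

Lemma tensor_ext (W : lmodType k) (f g : {linear tensor -> W}) :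
  (forall u v, f (tens u v) = g (tens u v)) -> f =1 g.
Proof.
by move=> h t; rewrite [t]tensE !linear_sum; apply: eq_bigr => p _.
Qed.

End Tensor.

Reserved Notation "\tsum_ ( a , b <- t ) E"
  (at level 41, E at level 41, a name, b name, t at level 50,
   format "'[' \tsum_ ( a ,  b  <-  t ) '/  '  E ']'").
Notation "\tsum_ ( a , b <- t ) E" := (tsum t (fun a b => E)) : ring_scope.
(* The k-module with carrier tensor U V. *)
Notation "U ⨂ V" := (Defs_tensor__canonical__GRing_Lmodule U V)
  (at level 40, left associativity).
Notation "u ⊗ v" := (tens u v) (at level 40, left associativity) : ring_scope.

Section TensorMap.
Variables (k : comPzRingType) (U U' V V' : lmodType k).
Variables (f : {linear U -> U'}) (g : {linear V -> V'}).

Definition tmap (t : U ⨂ V) : U' ⨂ V' := \tsum_(u, v <- t) f u ⊗ g v.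

Fact tmap_bilinear : bilinear_map (fun u v => f u ⊗ g v).
Proof.
split=> [v|u] a x y /=; rewrite linearP.
  exact: (tens_bilinear U' V').1.
exact: (tens_bilinear U' V').2.
Qed.

HB.instance Definition _ := GRing.isLinear.Build k (U ⨂ V) (U' ⨂ V') _ tmap
  (tlift_linear tmap_bilinear).

End TensorMap.

Definition tassoc_inv (k : comPzRingType) (U V W : lmodType k)
    (t : U ⨂ (V ⨂ W)) : U ⨂ V ⨂ W :=
  \tsum_(u, t' <- t) \tsum_(v, w <- t') u ⊗ v ⊗ w.

Section Dual.
Variables (k : comPzRingType) (V : lmodType k).

Definition linear_form : Type := {linear V -> k^o}.

HB.instance Definition _ := gen_eqMixin linear_form.
HB.instance Definition _ := gen_choiceMixin linear_form.

Lemma dual_ext (f g : linear_form) : f =1 g -> f = g.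
Proof.
case: f g => [f [[f1] [f2]]] [g [[g1] [g2]]] /= /funext fg.
case: _ / fg g1 g2 => g1 g2.
by rewrite (Prop_irrelevance f1 g1) (Prop_irrelevance f2 g2).
Qed.

Definition to_dual (f : V -> k^o) (hf : linear f) : linear_form :=
  HB.pack_for {linear V -> k^o} f (GRing.isLinear.Build k V k^o _ f hf).

Fact dual_add_linear (f g : linear_form) : linear (fun v => f v + g v : k^o).
Proof. by move=> a x y; rewrite !linearP scalerDr addrACA. Qed.
Fact dual_zero_linear : linear (fun _ : V => 0 : k^o).
Proof. by move=> a x y; rewrite scaler0 addr0. Qed.
Fact dual_scale_linear (c : k) (f : linear_form) : linear (fun v => c *: f v : k^o).
Proof. by move=> a x y; rewrite linearP scalerDr !scalerA [a * c]mulrC. Qed.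

Definition dual_add f g := to_dual (dual_add_linear f g).
Definition dual_zero := to_dual dual_zero_linear.
Definition dual_scale c f := to_dual (dual_scale_linear c f).
Definition dual_opp := dual_scale (- 1).

Fact dual_addA : associative dual_add.
Proof. by move=> f g h; apply: dual_ext => x /=; rewrite addrA. Qed.
Fact dual_addC : commutative dual_add.
Proof. by move=> f g; apply: dual_ext => x /=; rewrite addrC. Qed.
Fact dual_add0 : left_id dual_zero dual_add.
Proof. by move=> f; apply: dual_ext => x /=; rewrite add0r. Qed.
Fact dual_addN : left_inverse dual_zero dual_opp dual_add.
Proof. by move=> f; apply: dual_ext => x /=; rewrite scaleN1r addNr. Qed.

HB.instance Definition _ :=
  GRing.isZmodule.Build linear_form dual_addA dual_addC dual_add0 dual_addN.

Fact dual_scaleA a b f : dual_scale a (dual_scale b f) = dual_scale (a * b) f.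
Proof. by apply: dual_ext => x /=; rewrite scalerA. Qed.
Fact dual_scale1 : left_id 1 dual_scale.
Proof. by move=> f; apply: dual_ext => x /=; rewrite scale1r. Qed.
Fact dual_scaleDr : right_distributive dual_scale +%R.
Proof. by move=> a f g; apply: dual_ext => x /=; rewrite scalerDr. Qed.
Fact dual_scaleDl f : {morph dual_scale^~ f : a b / a + b}.
Proof. by move=> a b; apply: dual_ext => x /=; rewrite scalerDl. Qed.

HB.instance Definition _ := GRing.Zmodule_isLmodule.Build k linear_form
  dual_scaleA dual_scale1 dual_scaleDr dual_scaleDl.

End Dual.

(* The k-module with carrier linear_form V. *)
Notation dual V := (Defs_linear_form__canonical__GRing_Lmodule V).

Definition transpose (k : comPzRingType) (U V : lmodType k)
  (f : {linear U -> V}) (psi : linear_form V) : linear_form U := psi \o f.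

Section FinitelyGeneratedProjective.
Variables (k : comPzRingType) (V : lmodType k).

Definition finitely_generated : Prop :=
  exists (n : nat) (e : 'I_n -> V),
    forall v, exists c : 'I_n -> k, v = \sum_i c i *: e i.

Definition projective : Prop :=
  forall (A B : lmodType k) (p : {linear A -> B}) (f : {linear V -> B}),
    (forall b, exists a, p a = b) ->
    exists g : {linear V -> A}, forall v, p (g v) = f v.

Definition fg_projective : Prop := finitely_generated /\ projective.

Definition ev_std (t : V ⨂ dual V) : k^o := \tsum_(v, f <- t) (f : linear_form V) v.

Fact ev_std_bilinear : bilinear_map (fun (v : V) (f : linear_form V) => f v : k^o).
Proof. by split=> [f|v] a x y //=; rewrite linearP. Qed.

HB.instance Definition _ := GRing.isLinear.Build k (V ⨂ dual V) k^o _
  ev_std (tlift_linear ev_std_bilinear).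

(* The element \sum_i e^i ⊗ e_i of V^* ⊗ V, characterized by
   v = \sum_i e^i(v) e_i; it exists and is unique when V is finitely
   generated projective, the only case where this definition is used. *)
Definition dual_basis : dual V ⨂ V :=
  xget 0 [set t | forall v, v = \tsum_(f, e <- t) ((f : linear_form V) v : k) *: e].

Definition db_std (c : k^o) : dual V ⨂ V := (c : k) *: dual_basis.

Fact db_std_linear : linear db_std.
Proof. by move=> a x y; rewrite /db_std scalerDl -scalerA. Qed.

HB.instance Definition _ :=
  GRing.isLinear.Build k k^o (dual V ⨂ V) _ db_std db_std_linear.

End FinitelyGeneratedProjective.

Arguments ev_std {k} V.
Arguments db_std {k} V.
Arguments dual_basis {k} V.

Record lin_iso (k : comPzRingType) (U V : lmodType k) := LinIso {
  iso_fun :> {linear U -> V};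
  iso_inv : {linear V -> U};
  iso_funK : cancel iso_fun iso_inv;
  iso_invK : cancel iso_inv iso_fun
}.

Record category := Category {
  ob :> Type;
  hom : ob -> ob -> Type;
  idm : forall X, hom X X;
  comp : forall X Y Z, hom Y Z -> hom X Y -> hom X Z;
  comp_idl : forall X Y (f : hom X Y), comp (idm Y) f = f;
  comp_idr : forall X Y (f : hom X Y), comp f (idm X) = f;
  compA : forall X Y Z T (h : hom Z T) (g : hom Y Z) (f : hom X Y),
    comp h (comp g f) = comp (comp h g) f
}.
Arguments hom {c}.
Arguments idm {c} X.
Arguments comp {c X Y Z}.

Declare Scope cat_scope.
Delimit Scope cat_scope with cat.
Local Open Scope cat_scope.
Notation "g ∘ f" := (comp g f) (at level 40, left associativity) : cat_scope.

Definition inverse_morphisms (C : category) (X Y : C)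
  (f : hom X Y) (g : hom Y X) : Prop := g ∘ f = idm X /\ f ∘ g = idm Y.

Definition isomorphic (C : category) (X Y : C) : Prop :=
  exists (f : hom X Y) (g : hom Y X), inverse_morphisms f g.

(* Small sets are the carriers of choiceType. *)
Definition essentially_small (C : category) : Prop :=
  exists (S : choiceType) (G : S -> C), forall X, exists s, isomorphic (G s) X.

Reserved Notation "X ⊠ Y" (at level 40, left associativity).
Reserved Notation "f ⊠m g" (at level 40, left associativity).

Record monoidal := Monoidal {
  mon_cat :> category;
  tob : mon_cat -> mon_cat -> mon_cat
    where "X ⊠ Y" := (tob X Y);
  tmor : forall X X' Y Y',
    hom X X' -> hom Y Y' -> hom (X ⊠ Y) (X' ⊠ Y')
    where "f ⊠m g" := (tmor f g);
  tunit : mon_cat;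
  assoc : forall X Y Z, hom ((X ⊠ Y) ⊠ Z) (X ⊠ (Y ⊠ Z));
  assoc_inv : forall X Y Z, hom (X ⊠ (Y ⊠ Z)) ((X ⊠ Y) ⊠ Z);
  lunit : forall X, hom (tunit ⊠ X) X;
  lunit_inv : forall X, hom X (tunit ⊠ X);
  runit : forall X, hom (X ⊠ tunit) X;
  runit_inv : forall X, hom X (X ⊠ tunit);
  tmor_id : forall X Y, idm X ⊠m idm Y = idm (X ⊠ Y);
  tmor_comp : forall X X' X'' Y Y' Y''
    (f' : hom X' X'') (f : hom X X') (g' : hom Y' Y'') (g : hom Y Y'),
    (f' ∘ f) ⊠m (g' ∘ g) = (f' ⊠m g') ∘ (f ⊠m g);
  assoc_iso : forall X Y Z, inverse_morphisms (assoc X Y Z) (assoc_inv X Y Z);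
  lunit_iso : forall X, inverse_morphisms (lunit X) (lunit_inv X);
  runit_iso : forall X, inverse_morphisms (runit X) (runit_inv X);
  assoc_nat : forall X X' Y Y' Z Z'
    (f : hom X X') (g : hom Y Y') (h : hom Z Z'),
    assoc X' Y' Z' ∘ ((f ⊠m g) ⊠m h) = (f ⊠m (g ⊠m h)) ∘ assoc X Y Z;
  lunit_nat : forall X Y (f : hom X Y),
    lunit Y ∘ (idm tunit ⊠m f) = f ∘ lunit X;
  runit_nat : forall X Y (f : hom X Y),
    runit Y ∘ (f ⊠m idm tunit) = f ∘ runit X;
  pentagon : forall X Y Z T,
    assoc X Y (Z ⊠ T) ∘ assoc (X ⊠ Y) Z T =
    (idm X ⊠m assoc Y Z T) ∘ assoc X (Y ⊠ Z) T ∘ (assoc X Y Z ⊠m idm T);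
  triangle : forall X Y,
    (idm X ⊠m lunit Y) ∘ assoc X tunit Y = runit X ⊠m idm Y
}.
Arguments tob {m}.
Arguments tmor {m X X' Y Y'}.
Arguments tunit {m}.
Arguments assoc {m}.
Arguments assoc_inv {m}.
Arguments lunit {m}.
Arguments lunit_inv {m}.
Arguments runit {m}.
Arguments runit_inv {m}.
Notation "X ⊠ Y" := (tob X Y) : cat_scope.
Notation "f ⊠m g" := (tmor f g) : cat_scope.

Record right_duals (C : monoidal) := RightDuals {
  rdual : C -> C;
  ev : forall X : C, hom (X ⊠ rdual X) tunit;
  db : forall X : C, hom tunit (rdual X ⊠ X);
  rdual_zigzag : forall X : C,
    lunit X ∘ (ev X ⊠m idm X) ∘ assoc_inv X (rdual X) X ∘
      (idm X ⊠m db X) ∘ runit_inv X = idm X;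
  rdual_zagzig : forall X : C,
    runit (rdual X) ∘ (idm (rdual X) ⊠m ev X) ∘
      assoc (rdual X) X (rdual X) ∘
      (db X ⊠m idm (rdual X)) ∘ lunit_inv (rdual X) = idm (rdual X)
}.

(* g = f^⋆ *)
Definition is_rdual_mor (C : monoidal) (D : right_duals C) (X Y : C)
    (f : hom X Y) (g : hom (rdual D Y) (rdual D X)) : Prop :=
  ev D X ∘ (idm X ⊠m g) = ev D Y ∘ (f ⊠m idm (rdual D Y)).

Record quasi_monoidal_functor (k : comPzRingType) (C : monoidal) :=
  QuasiMonoidalFunctor {
  fob :> C -> lmodType k;
  fmap : forall X Y : C, hom X Y -> {linear fob X -> fob Y};
  fob_fgp : forall X, fg_projective (fob X);
  fmap_id : forall X x, fmap (idm X) x = x;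
  fmap_comp : forall (X Y Z : C) (g : hom Y Z) (f : hom X Y) x,
    fmap (g ∘ f) x = fmap g (fmap f x);
  phi0 : lin_iso k^o (fob tunit);
  phi : forall X Y, lin_iso (fob X ⨂ fob Y) (fob (X ⊠ Y));
  phi_nat : forall (X X' Y Y' : C) (f : hom X X') (g : hom Y Y') t,
    phi X' Y' (tmap (fmap f) (fmap g) t) = fmap (f ⊠m g) (phi X Y t)
}.
Arguments fmap {k C} q {X Y}.

Definition neutral (k : comPzRingType) (C : monoidal)
    (F : quasi_monoidal_functor k C) : Prop :=
  forall (X : C) (c : k^o) (x : F X),
    fmap F (lunit X) (phi F tunit X (phi0 F c ⊗ x)) = (c : k) *: x /\
    fmap F (runit X) (phi F X tunit (x ⊗ phi0 F c)) = (c : k) *: x.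

Record coquasi_data (k : comPzRingType) := CoquasiData {
  cq_mod :> lmodType k;
  Delta : {linear cq_mod -> cq_mod ⨂ cq_mod};
  eps : {linear cq_mod -> k^o};
  cq_m : {linear cq_mod ⨂ cq_mod -> cq_mod};
  cq_u : {linear k^o -> cq_mod};
  cq_omega : {linear cq_mod ⨂ cq_mod ⨂ cq_mod -> k^o};
  cq_omega_inv : {linear cq_mod ⨂ cq_mod ⨂ cq_mod -> k^o}
}.
Arguments Delta {k c}.
Arguments eps {k c}.

Definition cq_mul (k : comPzRingType) (H : coquasi_data k) (a b : H) : H :=
  cq_m H (a ⊗ b).
Definition cq_one (k : comPzRingType) (H : coquasi_data k) : H := cq_u H 1.
Definition omega (k : comPzRingType) (H : coquasi_data k) (a b c : H) : k :=
  cq_omega H (a ⊗ b ⊗ c).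
Definition omega_inv (k : comPzRingType) (H : coquasi_data k) (a b c : H) : k :=
  cq_omega_inv H (a ⊗ b ⊗ c).
Notation "a *h b" := (cq_mul a b) (at level 40, left associativity) : ring_scope.

Reserved Notation "\sw_ ( a , b <- h ) E"
  (at level 41, E at level 41, a name, b name, h at level 50,
   format "'[' \sw_ ( a ,  b  <-  h ) '/  '  E ']'").
Notation "\sw_ ( a , b <- h ) E" := (\tsum_(a, b <- Delta h) E) : ring_scope.

Record coquasi_bialgebra_axioms (k : comPzRingType) (H : coquasi_data k) : Prop := {
  Delta_coassoc : forall h : H,
    (\sw_(h1, h' <- h) \sw_(h2, h3 <- h') h1 ⊗ (h2 ⊗ h3)) =
    (\sw_(h', h3 <- h) \sw_(h1, h2 <- h') h1 ⊗ (h2 ⊗ h3));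
  eps_counitl : forall h : H, (\sw_(h1, h2 <- h) (eps h1 : k) *: h2) = h;
  eps_counitr : forall h : H, (\sw_(h1, h2 <- h) (eps h2 : k) *: h1) = h;
  mul_Delta : forall a b : H, Delta (a *h b) =
    \sw_(a1, a2 <- a) \sw_(b1, b2 <- b) (a1 *h b1) ⊗ (a2 *h b2);
  mul_eps : forall a b : H, eps (a *h b) = eps a * eps b;
  unit_Delta : Delta (cq_one H) = cq_one H ⊗ cq_one H;
  unit_eps : eps (cq_one H) = 1;
  omega_convr : forall a b c : H,
    (\sw_(a1, a2 <- a) \sw_(b1, b2 <- b) \sw_(c1, c2 <- c)
       (omega a1 b1 c1 * omega_inv a2 b2 c2 : k^o)) = eps a * eps b * eps c;
  omega_convl : forall a b c : H,
    (\sw_(a1, a2 <- a) \sw_(b1, b2 <- b) \sw_(c1, c2 <- c)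
       (omega_inv a1 b1 c1 * omega a2 b2 c2 : k^o)) = eps a * eps b * eps c;
  omega_cocycle : forall a b c d : H,
    (\sw_(a1, a2 <- a) \sw_(b1, b2 <- b) \sw_(c1, c2 <- c) \sw_(d1, d2 <- d)
       (omega a1 b1 (c1 *h d1) * omega (a2 *h b2) c2 d2 : k^o)) =
    (\sw_(a1, a2 <- a) \sw_(b1, b' <- b) \sw_(b2, b3 <- b')
     \sw_(c1, c' <- c) \sw_(c2, c3 <- c') \sw_(d1, d2 <- d)
       (omega b1 c1 d1 * omega a1 (b2 *h c2) d2 * omega a2 b3 c3 : k^o));
  omega_unit : forall a b : H, omega a (cq_one H) b = eps a * eps b;
  mul1h : forall a : H, cq_one H *h a = a;
  mulh1 : forall a : H, a *h cq_one H = a;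
  mul_quasi_assoc : forall a b c : H,
    (\sw_(a1, a2 <- a) \sw_(b1, b2 <- b) \sw_(c1, c2 <- c)
       omega a2 b2 c2 *: (a1 *h (b1 *h c1))) =
    (\sw_(a1, a2 <- a) \sw_(b1, b2 <- b) \sw_(c1, c2 <- c)
       omega a1 b1 c1 *: ((a2 *h b2) *h c2))
}.

Record coquasi_bialgebra (k : comPzRingType) := CoquasiBialgebra {
  cqb_data :> coquasi_data k;
  cqb_axioms : coquasi_bialgebra_axioms cqb_data
}.

Record coquasi_antipode (k : comPzRingType) (H : coquasi_bialgebra k)
    (s : {linear H -> H}) (alpha beta : linear_form H) : Prop := {
  antipode_Delta : forall h : H,
    Delta (s h) = \sw_(h1, h2 <- h) s h2 ⊗ s h1;
  antipode_eps : forall h : H, eps (s h) = eps h;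
  antipode_beta : forall h : H,
    (\sw_(h1, r <- h) \sw_(h2, h3 <- r) (beta h2 : k) *: (h1 *h s h3)) =
    (beta h : k) *: cq_one H;
  antipode_alpha : forall h : H,
    (\sw_(h1, r <- h) \sw_(h2, h3 <- r) (alpha h2 : k) *: (s h1 *h h3)) =
    (alpha h : k) *: cq_one H;
  antipode_omega : forall h : H,
    (\sw_(h1, r <- h) \sw_(h2, r' <- r) \sw_(h3, r'' <- r') \sw_(h4, h5 <- r'')
       (omega h1 ((beta h2 * alpha h4 : k) *: s h3) h5 : k^o)) = eps h;
  antipode_omega_inv : forall h : H,
    (\sw_(h1, r <- h) \sw_(h2, r' <- r) \sw_(h3, r'' <- r') \sw_(h4, h5 <- r'')
       (omega_inv (s h1) ((alpha h2 * beta h4 : k) *: h3) (s h5) : k^o)) = eps h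
}.

Definition coquasi_Hopf (k : comPzRingType) (H : coquasi_bialgebra k) : Prop :=
  exists (s : {linear H -> H}) (alpha beta : linear_form H),
    coquasi_antipode s alpha beta.

Section Comodules.
Variables (k : comPzRingType) (H : coquasi_bialgebra k).

Definition left_comodule (V : lmodType k) (d : {linear V -> H ⨂ V}) : Prop :=
  (forall v, (\tsum_(a, v0 <- d v) \sw_(a1, a2 <- a) a1 ⊗ (a2 ⊗ v0)) =
             (\tsum_(a, v' <- d v) \tsum_(b, v0 <- d v') a ⊗ (b ⊗ v0))) /\
  (forall v, (\tsum_(a, v0 <- d v) (eps a : k) *: v0) = v).

Definition comodule_map (V W : lmodType k) (dV : V -> H ⨂ V)
    (dW : W -> H ⨂ W) (f : {linear V -> W}) : Prop :=
  forall v, dW (f v) = \tsum_(a, v0 <- dV v) a ⊗ f v0.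

Definition unit_coact (c : k^o) : H ⨂ k^o := cq_one H ⊗ c.

Definition tensor_coact (V W : lmodType k) (dV : V -> H ⨂ V)
    (dW : W -> H ⨂ W) (t : V ⨂ W) : H ⨂ (V ⨂ W) :=
  \tsum_(v, w <- t) \tsum_(a, v0 <- dV v) \tsum_(b, w0 <- dW w)
    (a *h b) ⊗ (v0 ⊗ w0).

Definition comod_assoc (U V W : lmodType k) (dU : U -> H ⨂ U)
    (dV : V -> H ⨂ V) (dW : W -> H ⨂ W) (t : U ⨂ V ⨂ W) : U ⨂ (V ⨂ W) :=
  \tsum_(t', w <- t) \tsum_(u, v <- t')
    \tsum_(a, u0 <- dU u) \tsum_(b, v0 <- dV v) \tsum_(c, w0 <- dW w)
      omega_inv a b c *: (u0 ⊗ (v0 ⊗ w0)).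

Definition comod_assoc_inv (U V W : lmodType k) (dU : U -> H ⨂ U)
    (dV : V -> H ⨂ V) (dW : W -> H ⨂ W) (t : U ⨂ (V ⨂ W)) : U ⨂ V ⨂ W :=
  \tsum_(u, t' <- t) \tsum_(v, w <- t')
    \tsum_(a, u0 <- dU u) \tsum_(b, v0 <- dV v) \tsum_(c, w0 <- dW w)
      omega a b c *: (u0 ⊗ v0 ⊗ w0).

Definition klunit (V : lmodType k) (t : k^o ⨂ V) : V :=
  \tsum_(c, v <- t) (c : k) *: v.
Definition krunit (V : lmodType k) (t : V ⨂ k^o) : V :=
  \tsum_(v, c <- t) (c : k) *: v.

(* (W, dW) is a right dual of (V, dV), with evaluation e and dual basis map d,
   in the monoidal category of left H-comodules that are finitely generated
   projective over k. *)
Record comod_right_dual (V W : lmodType k)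
    (dV : {linear V -> H ⨂ V}) (dW : {linear W -> H ⨂ W})
    (e : {linear V ⨂ W -> k^o}) (d : {linear k^o -> W ⨂ V}) : Prop := {
  crd_fgpl : fg_projective V;
  crd_fgpr : fg_projective W;
  crd_comodl : left_comodule dV;
  crd_comodr : left_comodule dW;
  crd_ev : comodule_map (tensor_coact dV dW) unit_coact e;
  crd_db : comodule_map unit_coact (tensor_coact dW dV) d;
  crd_zigzag : forall v : V,
    klunit (tmap e idfun (comod_assoc_inv dV dW dV
      (tmap idfun d (v ⊗ (1 : k^o))))) = v;
  crd_zagzig : forall w : W,
    krunit (tmap idfun e (comod_assoc dW dV dW
      (tmap d idfun ((1 : k^o) ⊗ w)))) = w
}.

End Comodules.

Section Coendomorphisms.
Variables (k : comPzRingType) (C : monoidal) (F : quasi_monoidal_functor k C).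

Definition dinatural (V : lmodType k)
    (j : forall X : C, {linear F X ⨂ dual (F X) -> V}) : Prop :=
  forall (X Y : C) (f : hom X Y) (x : F X) (psi : linear_form (F Y)),
    j X (x ⊗ transpose (fmap F f) psi) = j Y (fmap F f x ⊗ psi).

(* i X (x ⊗ psi) is the class [x ⊗ psi] in the quotient H of the direct sum of
   the modules F X ⊗ (F X)^*. *)
Definition is_coend (H : lmodType k)
    (i : forall X : C, {linear F X ⨂ dual (F X) -> H}) : Prop :=
  dinatural i /\
  forall (V : lmodType k) (j : forall X : C, {linear F X ⨂ dual (F X) -> V}),
    dinatural j ->
    exists g : {linear H -> V},
      (forall X t, g (i X t) = j X t) /\
      (forall g' : {linear H -> V},
         (forall X t, g' (i X t) = j X t) -> g' =1 g).

Section Coaction.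
Variables (H : lmodType k) (i : forall X : C, {linear F X ⨂ dual (F X) -> H}).

Definition coact (X : C) (x : F X) : H ⨂ F X :=
  \tsum_(psi, e <- dual_basis (F X)) i X (x ⊗ psi) ⊗ e.

Fact coact_linear X : linear (@coact X).
Proof.
move=> a x y; rewrite /coact /tsum /formal_sum scaler_sumr -big_split /=.
apply: eq_bigr => p _.
have /= -> := (tens_bilinear (F X) (dual (F X))).1 p.1.
rewrite linearP.
by have /= -> := (tens_bilinear H (F X)).1 p.2.
Qed.

HB.instance Definition _ X :=
  GRing.isLinear.Build k (F X) (H ⨂ F X) _ (@coact X) (@coact_linear X).

End Coaction.

Record coendomorphism_bialgebra (H : coquasi_bialgebra k)
    (i : forall X : C, {linear F X ⨂ dual (F X) -> H}) : Prop := {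
  ceb_coend : is_coend i;
  ceb_comodule : forall X : C, left_comodule (@coact H i X);
  ceb_mul : forall (X Y : C) (x : F X) (y : F Y),
    (\tsum_(a, x0 <- coact i x) \tsum_(b, y0 <- coact i y)
       (a *h b) ⊗ phi F X Y (x0 ⊗ y0)) =
    coact i (phi F X Y (x ⊗ y));
  ceb_unit : cq_one H ⊗ phi0 F 1 = coact i (phi0 F 1);
  ceb_omega : forall (X Y Z : C) (x : F X) (y : F Y) (z : F Z),
    (\tsum_(a, x0 <- coact i x) \tsum_(b, y0 <- coact i y)
     \tsum_(c, z0 <- coact i z)
       omega a b c *: phi F (X ⊠ Y) Z (phi F X Y (x0 ⊗ y0) ⊗ z0)) =
    fmap F (assoc_inv X Y Z) (phi F X (Y ⊠ Z) (x ⊗ phi F Y Z (y ⊗ z)))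
}.

Section TransportedDuals.
Variables (D : right_duals C).
Variable nu : forall X : C, lin_iso (F (rdual D X)) (dual (F X)).

Definition dual_natural : Prop :=
  forall (X Y : C) (f : hom X Y) (g : hom (rdual D Y) (rdual D X)),
    is_rdual_mor f g ->
    forall u, nu X (fmap F g u) = transpose (fmap F f) (nu Y u).

Definition ev_F (X : C) : {linear F X ⨂ F (rdual D X) -> k^o} :=
  iso_inv (phi0 F) \o fmap F (ev D X) \o phi F X (rdual D X).

Definition db_F (X : C) : {linear k^o -> F (rdual D X) ⨂ F X} :=
  iso_inv (phi F (rdual D X) X) \o fmap F (db D X) \o phi0 F.

Definition ev_star (X : C) : {linear F X ⨂ dual (F X) -> k^o} :=
  ev_F X \o tmap idfun (iso_inv (nu X)).

Definition db_star (X : C) : {linear k^o -> dual (F X) ⨂ F X} :=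
  tmap (nu X) idfun \o db_F X.

Definition coact_dual (H : lmodType k)
    (i : forall X : C, {linear F X ⨂ dual (F X) -> H}) (X : C) :
    {linear dual (F X) -> H ⨂ dual (F X)} :=
  tmap idfun (nu X) \o @coact H i (rdual D X) \o iso_inv (nu X).

Variables (H : lmodType k) (i : forall X : C, {linear F X ⨂ dual (F X) -> H}).

Definition alpha_equation (alpha : linear_form H) : Prop :=
  forall (X : C) (x : F X),
    tmap alpha idfun (coact i x) =
    tmap (@ev_std k (F X)) idfun (tassoc_inv (x ⊗ db_star X 1)).

Definition beta_equation (beta : linear_form H) : Prop :=
  forall (X : C) (x : F X),
    tmap beta idfun (coact i x) =
    tmap (ev_star X) idfun (tassoc_inv (x ⊗ db_std (F X) 1)).

Definition antipode_equation (s : {linear H -> H}) : Prop :=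
  forall (X : C) (x : F X),
    tmap s idfun (coact i x) =
    \tsum_(f, e <- db_std (F X) 1) \tsum_(a, f0 <- coact_dual i X f)
      a ⊗ ((ev_std (F X) (x ⊗ f0) : k) *: e).

End TransportedDuals.
End Coendomorphisms.

(* Main.v *)
From HB Require Import structures.
From mathcomp Require Import all_boot all_algebra.
From mathcomp Require Import classical_sets.
Require Import Defs.

Set Implicit Arguments.
Unset Strict Implicit.
Unset Printing Implicit Defensive.

Import GRing.Theory.
Local Open Scope ring_scope.

(** The k-module H is spanned by the coefficients [x ⊗ psi], with x in F X and
    psi in the dual of F X, and linear maps out of H are the same as dinatural
    families of bilinear maps (coend_lift, coend_ext). In these coordinates,
    alpha pairs x and psi with db^*(1), beta is ev^*, and s sends [x ⊗ psi] to
    the coefficient of X^⋆ formed by nu^-1(psi) and by evaluation at x.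

    Dinaturality of the three families follows from the naturality of nu and
    from the existence in C of a transpose of every morphism. The transpose is
    determined by its compatibility with ev; alpha needs its compatibility
    with db as well (db_rdual_mor), a computation with Kelly's coherence
    lemmas in a monoidal category that is not assumed strict.

    The coaction makes every F(f), phi and phi0 a comodule map, omega computes
    F(a^-1), hence omega_inv computes F(a) (omega_inv_coact), and neutrality
    matches the unit constraints. The duality data of X in C are thus carried by F
    to comodule maps ev^* and db^* that satisfy the zigzag identities
    (ev_db_star, db_ev_star), so the transported dual is a right dual among
    comodules.

    Each axiom of a coquasi-antipode is then one of these facts read on a
    coefficient [x ⊗ psi]: the axioms on Delta and eps say that the dual is a
    comodule with coefficients s[x ⊗ psi], the axioms for beta and alpha are the
    colinearity of ev^* and of db^*, and the axioms for omega and omega_inv are the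
    two zigzags. *)

(** * Coherence in monoidal categories *)

Section Coherence.
Variable C : monoidal.
Local Open Scope cat_scope.
Implicit Types X Y Z A B : C.

Lemma assocK X Y Z : assoc_inv X Y Z ∘ assoc X Y Z = idm _.
Proof. exact: (assoc_iso X Y Z).1. Qed.
Lemma assocVK X Y Z : assoc X Y Z ∘ assoc_inv X Y Z = idm _.
Proof. exact: (assoc_iso X Y Z).2. Qed.
Lemma lunitK X : lunit_inv X ∘ lunit X = idm _.
Proof. exact: (lunit_iso X).1. Qed.
Lemma lunitVK X : lunit X ∘ lunit_inv X = idm _.
Proof. exact: (lunit_iso X).2. Qed.
Lemma runitK X : runit_inv X ∘ runit X = idm _.
Proof. exact: (runit_iso X).1. Qed.
Lemma runitVK X : runit X ∘ runit_inv X = idm _.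
Proof. exact: (runit_iso X).2. Qed.

Lemma tmor_compl X A A' A'' (f : hom A' A'') (g : hom A A') :
  idm X ⊠m (f ∘ g) = (idm X ⊠m f) ∘ (idm X ⊠m g).
Proof. by rewrite -tmor_comp comp_idl. Qed.
Lemma tmor_compr Y A A' A'' (f : hom A' A'') (g : hom A A') :
  (f ∘ g) ⊠m idm Y = (f ⊠m idm Y) ∘ (g ⊠m idm Y).
Proof. by rewrite -tmor_comp comp_idl. Qed.
Lemma tmor_swap X X' Y Y' (f : hom X X') (g : hom Y Y') :
  (f ⊠m idm Y') ∘ (idm X ⊠m g) = (idm X' ⊠m g) ∘ (f ⊠m idm Y).
Proof. by rewrite -!tmor_comp !comp_idl !comp_idr. Qed.

(** An isomorphism p is cancelled with the help of a one-sided inverse q. *)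
Lemma cancel_precomp X Y Z (p : hom X Y) (q : hom Y X) (f g : hom Y Z) :
  p ∘ q = idm Y -> f ∘ p = g ∘ p -> f = g.
Proof. by move=> pq e; rewrite -[f]comp_idr -[g]comp_idr -pq !compA e. Qed.
Lemma cancel_postcomp X Y Z (p : hom Y Z) (q : hom Z Y) (f g : hom X Y) :
  q ∘ p = idm Y -> p ∘ f = p ∘ g -> f = g.
Proof. by move=> qp e; rewrite -[f]comp_idl -[g]comp_idl -qp -!compA e. Qed.

(** Rewrites with a ∘ b = c inside a composite nested to the right. *)
Lemma precomp_eq X Y Z A (a : hom Y Z) (b : hom X Y) (c : hom X Z) :
  a ∘ b = c -> forall w : hom A X, a ∘ (b ∘ w) = c ∘ w.
Proof. by move=> <- w; rewrite compA. Qed.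

(** Tensoring with the unit object is faithful, being naturally isomorphic to
    the identity functor. *)
Lemma tmor_unitl_inj X Y (f g : hom X Y) :
  idm tunit ⊠m f = idm tunit ⊠m g -> f = g.
Proof.
move=> e; apply: (cancel_precomp (lunitVK X)).
by rewrite -!lunit_nat e.
Qed.
Lemma tmor_unitr_inj X Y (f g : hom X Y) :
  f ⊠m idm tunit = g ⊠m idm tunit -> f = g.
Proof.
move=> e; apply: (cancel_precomp (runitVK X)).
by rewrite -!runit_nat e.
Qed.

(** Kelly: the pentagon on (I, I, X, Y) and two triangles give the equation
    after tensoring with I on the left, which is faithful. *)
Lemma lunit_tob X Y : lunit (X ⊠ Y) ∘ assoc tunit X Y = lunit X ⊠m idm Y.
Proof.
apply: tmor_unitl_inj.
apply: (@cancel_precomp _ _ _ (assoc tunit (tunit ⊠ X) Y ∘ (assoc tunit tunit X ⊠m idm Y))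
  ((assoc_inv tunit tunit X ⊠m idm Y) ∘ assoc_inv tunit (tunit ⊠ X) Y)).
  by rewrite compA -[_ ∘ (assoc_inv _ _ _ ⊠m _)]compA -tmor_compr assocVK
    tmor_id comp_idr assocVK.
rewrite tmor_compl compA -!compA [_ ∘ (_ ∘ (assoc _ _ _ ⊠m _))]compA -pentagon.
rewrite compA triangle [RHS]compA -assoc_nat -compA -tmor_compr triangle.
by rewrite assoc_nat tmor_id.
Qed.

(** The mirror image of the preceding fact, from the pentagon on (X, Y, I, I). *)
Lemma runit_tob X Y : (idm X ⊠m runit Y) ∘ assoc X Y tunit = runit (X ⊠ Y).
Proof.
apply: tmor_unitr_inj.
apply: (cancel_postcomp (assocK X Y tunit)).
rewrite tmor_compr compA assoc_nat -triangle tmor_compl -!compA.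
rewrite [_ ⊠m _ ∘ (assoc _ _ _ ∘ _)]compA -pentagon.
by rewrite compA -assoc_nat tmor_id -[LHS]compA triangle.
Qed.

(** Both become equal after tensoring with I on the right: naturality of l at
    l_I identifies l on I ⊠ I with I ⊠ l_I, and the triangle concludes. *)
Lemma lunit_runit_unit : lunit tunit = runit tunit :> hom (tunit ⊠ @tunit C) tunit.
Proof.
apply: tmor_unitr_inj; rewrite -lunit_tob -triangle; congr (_ ∘ _).
apply: (cancel_postcomp (lunitK (@tunit C))).
by rewrite lunit_nat.
Qed.

Lemma assoc_inv_nat X X' Y Y' Z Z' (f : hom X X') (g : hom Y Y') (h : hom Z Z') :
  assoc_inv X' Y' Z' ∘ (f ⊠m (g ⊠m h)) = ((f ⊠m g) ⊠m h) ∘ assoc_inv X Y Z.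
Proof.
apply: (cancel_postcomp (assocK X' Y' Z')).
by rewrite !compA assocVK comp_idl assoc_nat -compA assocVK comp_idr.
Qed.

Lemma lunit_inv_nat X Y (f : hom X Y) :
  lunit_inv Y ∘ f = (idm tunit ⊠m f) ∘ lunit_inv X.
Proof.
apply: (cancel_postcomp (lunitK Y)).
by rewrite !compA lunitVK comp_idl lunit_nat -compA lunitVK comp_idr.
Qed.

Lemma runit_inv_nat X Y (f : hom X Y) :
  runit_inv Y ∘ f = (f ⊠m idm tunit) ∘ runit_inv X.
Proof.
apply: (cancel_postcomp (runitK Y)).
by rewrite !compA runitVK comp_idl runit_nat -compA runitVK comp_idr.
Qed.

Lemma pentagon_inv X Y Z T :
  assoc_inv X Y (Z ⊠ T) ∘ (idm X ⊠m assoc Y Z T) =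
  assoc (X ⊠ Y) Z T ∘ (assoc_inv X Y Z ⊠m idm T) ∘ assoc_inv X (Y ⊠ Z) T.
Proof.
apply: (cancel_postcomp (assocK X Y (Z ⊠ T))).
rewrite !compA assocVK comp_idl pentagon -!compA.
by rewrite [_ ∘ (_ ∘ assoc_inv _ _ _)]compA -tmor_compr assocVK tmor_id
  comp_idl assocVK comp_idr.
Qed.

Lemma triangle_inv X Y :
  assoc_inv X tunit Y ∘ (idm X ⊠m lunit_inv Y) = runit_inv X ⊠m idm Y.
Proof.
apply: (@cancel_postcomp _ _ _ (runit X ⊠m idm Y) (runit_inv X ⊠m idm Y)).
  by rewrite -tmor_compr runitK tmor_id.
rewrite -tmor_compr runitVK tmor_id -triangle -!compA (precomp_eq (assocVK _ _ _)).
by rewrite comp_idl -tmor_compl lunitVK tmor_id.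
Qed.

Lemma runit_tob_inv X Y :
  assoc X Y tunit ∘ runit_inv (X ⊠ Y) = idm X ⊠m runit_inv Y.
Proof.
apply: (@cancel_postcomp _ _ _ (idm X ⊠m runit Y) (idm X ⊠m runit_inv Y)).
  by rewrite -tmor_compl runitK tmor_id.
by rewrite (precomp_eq (runit_tob _ _)) runitVK -tmor_compl runitVK tmor_id.
Qed.

Lemma lunit_tob_inv X Y :
  assoc_inv tunit X Y ∘ lunit_inv (X ⊠ Y) = lunit_inv X ⊠m idm Y.
Proof.
apply: (@cancel_postcomp _ _ _ (lunit X ⊠m idm Y) (lunit_inv X ⊠m idm Y)).
  by rewrite -tmor_compr lunitK tmor_id.
rewrite -tmor_compr lunitVK tmor_id -lunit_tob -compA (precomp_eq (assocVK _ _ _)).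
by rewrite comp_idl lunitVK.
Qed.

Lemma lunit_runit_unit_inv :
  lunit_inv tunit = runit_inv tunit :> hom (@tunit C) (tunit ⊠ tunit).
Proof.
by rewrite -[LHS]comp_idl -runitK -lunit_runit_unit -compA lunitVK comp_idr.
Qed.

End Coherence.

(** * Transposed morphisms in a right rigid category *)

Section DualMorphism.
Variables (C : monoidal) (D : right_duals C).
Local Open Scope cat_scope.
Implicit Types X Y Z A B : C.

(** The adjunction between X ⊠ - and X^⋆ ⊠ - (one half of it), at the unit
    object: the inverse of g |-> ev_X (X ⊠ g). *)
Definition curry X A (h : hom (X ⊠ A) tunit) : hom A (rdual D X) :=
  runit (rdual D X) ∘ (idm (rdual D X) ⊠m h) ∘ assoc (rdual D X) X A ∘
  (db D X ⊠m idm A) ∘ lunit_inv A.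

(** Sliding h past ev_X leaves the zigzag of X tensored with A. *)
Lemma ev_curry X A (h : hom (X ⊠ A) tunit) : ev D X ∘ (idm X ⊠m curry h) = h.
Proof.
rewrite /curry !tmor_compl -!compA.
have /precomp_eq -> : ev D X ∘ (idm X ⊠m runit (rdual D X)) =
    lunit tunit ∘ (ev D X ⊠m idm tunit) ∘ assoc_inv X (rdual D X) tunit.
  apply: (cancel_precomp (assocVK _ _ _)).
  by rewrite -compA runit_tob -compA assocK comp_idr lunit_runit_unit runit_nat.
rewrite -!compA (precomp_eq (assoc_inv_nat _ _ _)) -!compA.
rewrite tmor_id (precomp_eq (tmor_swap _ _)) -!compA (precomp_eq (lunit_nat _)) -!compA.
rewrite (precomp_eq (pentagon_inv _ _ _ _)) -!compA.
rewrite (precomp_eq (assoc_inv_nat _ _ _)) -!compA triangle_inv.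
rewrite -(tmor_id X A) (precomp_eq (esym (assoc_nat _ _ _))) -!compA (precomp_eq (lunit_tob _ _)).
by rewrite -!tmor_compr !compA rdual_zigzag tmor_id comp_idr.
Qed.

(** Sliding db_Y past db_X gathers everything to the right of X^⋆ into a single
    morphism X -> Y. *)
Lemma db_curry X Y (h : hom (X ⊠ rdual D Y) tunit) :
  (curry h ⊠m idm Y) ∘ db D Y =
  (idm (rdual D X) ⊠m (lunit Y ∘ (h ⊠m idm Y) ∘ assoc_inv X (rdual D Y) Y ∘
     (idm X ⊠m db D Y) ∘ runit_inv X)) ∘ db D X.
Proof.
rewrite /curry !tmor_compr -!compA -lunit_tob_inv -!compA lunit_inv_nat.
rewrite (precomp_eq (esym (assoc_inv_nat _ _ _))) tmor_id -!compA.
rewrite (precomp_eq (tmor_swap _ _)) -!compA lunit_runit_unit_inv -runit_inv_nat.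
rewrite -triangle -!compA (precomp_eq (assoc_nat _ _ _)) -!compA.
rewrite !tmor_compl -!compA; congr (_ ∘ (_ ∘ _)).
rewrite -runit_tob_inv -!compA -(tmor_id (rdual D X) X).
rewrite (precomp_eq (esym (assoc_nat _ _ _))) -!compA.
apply: (@cancel_postcomp _ _ _ _ (idm _ ⊠m assoc X (rdual D Y) Y)
  (idm _ ⊠m assoc_inv X (rdual D Y) Y)).
  by rewrite -tmor_compl assocK tmor_id.
rewrite (precomp_eq (esym (tmor_compl _ _ _))) assocVK !tmor_id comp_idl.
by rewrite [_ ⊠m assoc _ _ _ ∘ (assoc _ _ _ ∘ _)]compA
  (precomp_eq (esym (pentagon _ _ _ _))) -!compA (precomp_eq (assocVK _ _ _)) comp_idl.
Qed.

Definition rdual_mor X Y (f : hom X Y) : hom (rdual D Y) (rdual D X) :=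
  curry (ev D Y ∘ (f ⊠m idm (rdual D Y))).

Lemma rdual_morP X Y (f : hom X Y) : is_rdual_mor f (rdual_mor f).
Proof. exact: ev_curry. Qed.

(** The dual morphism is characterized through ev; that it is also compatible
    with db follows from the zigzag of Y. This is what makes alpha dinatural. *)
Lemma db_rdual_mor X Y (f : hom X Y) :
  (rdual_mor f ⊠m idm Y) ∘ db D Y = (idm (rdual D X) ⊠m f) ∘ db D X.
Proof.
rewrite /rdual_mor db_curry; congr ((_ ⊠m _) ∘ _).
rewrite -[RHS]comp_idl -[in RHS](rdual_zigzag D Y) -!compA runit_inv_nat tmor_compr -!compA.
by rewrite (precomp_eq (esym (assoc_inv_nat _ _ _))) tmor_id -!compA
  (precomp_eq (tmor_swap _ _)) -!compA.
Qed.
End DualMorphism.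

(** * Linearity of explicit expressions *)

Section LinearityRules.
Variable k : comPzRingType.
Implicit Types U V W A B : lmodType k.

Lemma lin_id U : linear (fun x : U => x).
Proof. by []. Qed.
Lemma lin_comp U V W (g : V -> W) (f : U -> V) :
  linear g -> linear f -> linear (fun x => g (f x)).
Proof. by move=> hg hf a x y; rewrite hf hg. Qed.
Lemma lin_app U V W (g : {linear V -> W}) (f : U -> V) :
  linear f -> linear (fun x => g (f x)).
Proof. by apply: lin_comp; apply: linearP. Qed.
Lemma lin_form U V (g : U -> linear_form V) v :
  linear (g : U -> dual V) -> linear (fun x => g x v : k^o).
Proof. by move=> hg a x y; rewrite hg. Qed.
Lemma lin_tensl U V W (f : U -> V) (w : W) :
  linear f -> linear (fun x => f x ⊗ w).
Proof. by move=> hf a x y; rewrite hf; apply: (tens_bilinear V W).1. Qed.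
Lemma lin_tensr U V W (f : U -> W) (v : V) :
  linear f -> linear (fun x => v ⊗ f x).
Proof. by move=> hf a x y; rewrite hf; apply: (tens_bilinear V W).2. Qed.
Lemma lin_scalel U V (f : U -> k^o) (v : V) :
  linear f -> linear (fun x => (f x : k) *: v).
Proof. by move=> hf a x y; rewrite hf scalerDl scalerA. Qed.
Lemma lin_scaler U V (f : U -> V) (c : k) :
  linear f -> linear (fun x => c *: f x).
Proof. by move=> hf a x y; rewrite hf scalerDr !scalerA mulrC. Qed.
Lemma lin_mull U (f : U -> k^o) (c : k) :
  linear f -> linear (fun x => f x * c : k^o).
Proof. by move=> hf a x y; rewrite hf mulrDl; congr (_ + _); apply/esym/mulrA. Qed.
Lemma lin_mulr U (f : U -> k^o) (c : k) :
  linear f -> linear (fun x => c * f x : k^o).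
Proof. by move=> hf a x y; rewrite hf mulrDr; congr (_ + _); apply: mulrCA. Qed.
Lemma lin_tsum_body U A B W (t : A ⨂ B) (f : U -> A -> B -> W) :
  (forall a b, linear (fun x => f x a b)) -> linear (fun x => tsum t (f x)).
Proof.
move=> hf a x y; rewrite /tsum /formal_sum scaler_sumr -big_split.
by apply: eq_bigr => p _; rewrite hf.
Qed.
Lemma lin_tsum_arg U A B W (t : U -> A ⨂ B) (f : A -> B -> W) :
  bilinear_map f -> linear t -> linear (fun x => tsum (t x) f).
Proof. by move=> hf ht a x y; rewrite ht; apply: tlift_linear. Qed.
Lemma lin_tmap U A A' B B' (f : {linear A -> A'}) (g : {linear B -> B'}) (t : U -> A ⨂ B) :
  linear t -> linear (fun x => tmap f g (t x)).
Proof. exact: (@lin_app _ _ _ (tmap f g)). Qed.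

End LinearityRules.

(** A Sweedler sum over an expanded tensor may be computed termwise only when
    its body is bilinear, so bilinearity of explicit expressions is a side
    condition of almost every rewriting step below; this tactic discharges it
    by following the syntax of the expression.  A pattern variable standing
    for a subterm free of x can be matched with one that contains x; the
    application of the rule then fails and the next rule is tried. *)
Ltac linear_step :=
  cbv beta;
  match goal with
  | |- bilinear_map _ => split=> ?
  | |- forall _, _ => intro
  | |- GRing.linear_for _ (fun x => x) => apply: lin_id
  | |- GRing.linear_for _ (fun x => tens (@?f x) ?v) => apply: (@lin_tensl _ _ _ _ f v)
  | |- GRing.linear_for _ (fun x => tens ?v (@?f x)) => apply: (@lin_tensr _ _ _ _ f v)
  | |- GRing.linear_for _ (fun x => tsum ?t (fun a b => @?f x a b)) =>
      apply: (@lin_tsum_body _ _ _ _ _ t f)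
  | |- GRing.linear_for _ (fun x => tsum (@?t x) ?f) =>
      apply: (@lin_tsum_arg _ _ _ _ _ t f)
  | |- GRing.linear_for _ (fun x => GRing.scale ?c (@?f x)) => apply: (@lin_scaler _ _ _ f c)
  | |- GRing.linear_for _ (fun x => GRing.scale (@?f x) ?v) => apply: (@lin_scalel _ _ _ f v)
  | |- GRing.linear_for _ (fun x => GRing.mul ?c (@?f x)) => apply: (@lin_mulr _ _ f c)
  | |- GRing.linear_for _ (fun x => GRing.mul (@?f x) ?c) => apply: (@lin_mull _ _ f c)
  | |- GRing.linear_for _ (fun x => tmap ?f ?g (@?t x)) => apply: (@lin_tmap _ _ _ _ _ _ f g t)
  | |- GRing.linear_for _ (fun x => coact ?i (@?f x)) =>
      apply: (@lin_comp _ _ _ _ (@coact _ _ _ _ i _) f); first exact: coact_linear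
  | |- GRing.linear_for _ (fun x => GRing.Linear.sort ?g (@?f x)) => apply: (@lin_app _ _ _ _ g f)
  | |- GRing.linear_for _ (fun x => GRing.Linear.sort (@?g x) ?v) => apply: (@lin_form _ _ _ g v)
  | |- GRing.linear_for _ (fun x => ?g (@?f x)) =>
      apply: (@lin_comp _ _ _ _ g f); first solve [auto]
  | |- GRing.linear_for _ (fun x => ?g (@?f x) ?v) =>
      apply: (@lin_comp _ _ _ _ (fun y => g y v) f); first solve [auto]
  | |- GRing.linear_for _ (tens ?v) => exact: (tens_bilinear _ _).2
  | |- GRing.linear_for _ ?f => exact: linearP
  | |- GRing.linear_for _ ?f => solve [auto]
  | |- GRing.linear_for _ ?f => is_var f; unfold f
  end.
Ltac prove_linear := rewrite /cq_mul /omega /omega_inv; repeat (once linear_step).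

(** * Calculus of Sweedler sums *)

Section TensorSums.
Variable k : comPzRingType.
Implicit Types U V W A B : lmodType k.

Lemma eq_tsum U V W (t : U ⨂ V) (f g : U -> V -> W) :
  (forall u v, f u v = g u v) -> tsum t f = tsum t g.
Proof. by move=> e; apply: eq_bigr => p _. Qed.

(** A Sweedler sum is a finite sum over a representative, so linear maps commute
    with it whether or not its body f is bilinear. *)
Lemma tsum_lin U V W A (t : U ⨂ V) (f : U -> V -> W) (g : W -> A) : linear g ->
  g (tsum t f) = \tsum_(u, v <- t) g (f u v).
Proof.
move=> hg; rewrite -[g]/(GRing.Linear.sort (HB.pack_for {linear W -> A} g
  (GRing.isLinear.Build k W A _ g hg))).
exact: linear_sum.
Qed.

Lemma tsum_exchange U V A B W (t : U ⨂ V) (s : A ⨂ B) (f : U -> V -> A -> B -> W) :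
  \tsum_(u, v <- t) \tsum_(a, b <- s) f u v a b = \tsum_(a, b <- s) \tsum_(u, v <- t) f u v a b.
Proof. exact: exchange_big. Qed.

Lemma tsum_scalel U V W (t : U ⨂ V) (f : U -> V -> k^o) (w : W) :
  \tsum_(u, v <- t) (f u v : k) *: w = (tsum t f : k) *: w.
Proof. by rewrite /tsum /formal_sum scaler_suml. Qed.

Lemma tsumZ U V W (t : U ⨂ V) (c : k) (f : U -> V -> W) :
  \tsum_(u, v <- t) c *: f u v = c *: tsum t f.
Proof. by rewrite /tsum /formal_sum scaler_sumr. Qed.

Lemma tensZl U V (c : k) (u : U) (v : V) : (c *: u) ⊗ v = c *: (u ⊗ v).
Proof. by have /scalable_linear -> := (tens_bilinear U V).1 v. Qed.
Lemma tensZr U V (c : k) (u : U) (v : V) : u ⊗ (c *: v) = c *: (u ⊗ v).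
Proof. by have /scalable_linear -> := (tens_bilinear U V).2 u. Qed.

Lemma tsum_tens U V (t : U ⨂ V) : \tsum_(u, v <- t) u ⊗ v = t.
Proof. exact/esym/tensE. Qed.

Lemma tsum_tsum U V A B W (t : U ⨂ V) (g : U -> V -> A ⨂ B) (f : A -> B -> W) :
  bilinear_map f ->
  tsum (\tsum_(u, v <- t) g u v) f = \tsum_(u, v <- t) tsum (g u v) f.
Proof. by move=> hf; rewrite (tsum_lin t _ (tlift_linear hf)). Qed.

(** A Sweedler sum over a sum of elementary tensors is computed term by term. *)
Lemma tsum_bind U V A B W (t : U ⨂ V) (g : U -> V -> A) (h : U -> V -> B) (f : A -> B -> W) :
  bilinear_map f ->
  tsum (\tsum_(u, v <- t) g u v ⊗ h u v) f = \tsum_(u, v <- t) f (g u v) (h u v).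
Proof.
move=> hf; rewrite (tsum_lin t _ (tlift_linear hf)).
by apply: eq_tsum => u v; rewrite tliftE.
Qed.

Lemma tsum_tmap U V A B W (f : {linear U -> A}) (g : {linear V -> B}) (t : U ⨂ V)
    (h : A -> B -> W) :
  bilinear_map h -> tsum (tmap f g t) h = \tsum_(u, v <- t) h (f u) (g v).
Proof. exact: tsum_bind. Qed.

Lemma tmap_tens U V A B (f : {linear U -> A}) (g : {linear V -> B}) u v :
  tmap f g (u ⊗ v) = f u ⊗ g v.
Proof. by rewrite /tmap tliftE //; apply: tmap_bilinear. Qed.

Lemma tmap_tsum U V A B U' V' (f : {linear U -> A}) (g : {linear V -> B})
    (t : U' ⨂ V') (h : U' -> V' -> U ⨂ V) :
  tmap f g (tsum t h) = \tsum_(u, v <- t) tmap f g (h u v).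
Proof. exact: linear_sum. Qed.

Lemma tmap_tsum_tens U V A B U' V' (f : {linear U -> A}) (g : {linear V -> B})
    (t : U' ⨂ V') (h1 : U' -> V' -> U) (h2 : U' -> V' -> V) :
  tmap f g (\tsum_(u, v <- t) h1 u v ⊗ h2 u v) = \tsum_(u, v <- t) f (h1 u v) ⊗ g (h2 u v).
Proof. by rewrite tmap_tsum; apply: eq_tsum => u v; rewrite tmap_tens. Qed.

Definition tlift U V W (f : U -> V -> W) (hf : bilinear_map f) : {linear U ⨂ V -> W} :=
  HB.pack_for {linear U ⨂ V -> W} (fun t : U ⨂ V => tsum t f)
    (GRing.isLinear.Build k (U ⨂ V) W _ _ (tlift_linear hf)).

Lemma tliftP U V W (f : U -> V -> W) (hf : bilinear_map f) u v : tlift hf (u ⊗ v) = f u v.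
Proof. exact: tliftE. Qed.

Lemma tensor_ext_lin U V W (f g : U ⨂ V -> W) : linear f -> linear g ->
  (forall u v, f (u ⊗ v) = g (u ⊗ v)) -> f =1 g.
Proof.
move=> hf hg e t; rewrite -[t]tsum_tens (tsum_lin _ _ hf) (tsum_lin _ _ hg).
exact: eq_tsum.
Qed.

Lemma tsum_sum U V W n (t : 'I_n -> U ⨂ V) (f : U -> V -> W) : bilinear_map f ->
  tsum (\sum_j t j) f = \sum_j tsum (t j) f.
Proof. by move=> hf; apply: (linear_sum (tlift hf)). Qed.

End TensorSums.

(** * Dual bases of finitely generated projective modules *)

Section DualBasis.
Variables (k : comPzRingType) (V : lmodType k).
Hypothesis V_fgp : fg_projective V.

(** A surjection from the free module k^n onto V splits; the coordinates of the
    splitting are the covectors of a dual basis. *)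
Lemma dual_basisP (v : V) :
  v = \tsum_(f, e <- dual_basis V) ((f : linear_form V) v : k) *: e.
Proof.
rewrite /dual_basis; case: xgetP => [t _|nex]; first by [].
have [[n [e gen]] proj] := V_fgp.
pose p (c : 'rV[k]_n) := \sum_j c 0 j *: e j.
have p_lin : linear p.
  move=> a x y; rewrite /p scaler_sumr -big_split; apply: eq_bigr => j _.
  by rewrite !mxE scalerDl scalerA.
pose pL : {linear 'rV[k]_n -> V} := HB.pack_for {linear 'rV[k]_n -> V} p
  (GRing.isLinear.Build k 'rV[k]_n V _ p p_lin).
have [|g gK] := proj _ _ pL idfun.
  move=> b; have [c ->] := gen b; exists (\row_j c j); apply: eq_bigr => j _.
  by rewrite mxE.
have cov_lin j : linear (fun v => g v 0 j : k^o).
  by move=> a x y; rewrite linearP !mxE.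
case: (nex (\sum_j (to_dual (cov_lin j) : dual V) ⊗ e j)) => w /=.
rewrite tsum_sum; last by prove_linear.
have {1}<- : p (g w) = w := gK w.
apply: eq_bigr => j _; rewrite tliftE //.
by prove_linear.
Qed.

Lemma dual_basis_vec (W : lmodType k) (g : V -> W) (v : V) : linear g ->
  \tsum_(f, e <- dual_basis V) ((f : linear_form V) v : k) *: g e = g v.
Proof.
move=> hg; rewrite {2}(dual_basisP v) (tsum_lin _ _ hg).
by apply: eq_tsum => f e; rewrite (scalable_linear hg).
Qed.

Lemma dual_basis_form (W : lmodType k) (g : dual V -> W) (psi : linear_form V) : linear g ->
  \tsum_(f, e <- dual_basis V) (psi e : k) *: g f = g psi.
Proof.
move=> hg; have {2}-> : psi = \tsum_(f, e <- dual_basis V) (psi e : k) *: (f : dual V).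
  apply: dual_ext => v; rewrite {1}(dual_basisP v).
  rewrite (@tsum_lin _ _ _ _ _ _ _ psi); last exact: linearP.
  rewrite (@tsum_lin _ _ _ _ _ _ _ (fun f : dual V => (f : linear_form V) v)) //.
  by apply: eq_tsum => f e; rewrite linearZ /= [RHS]mulrC.
rewrite (tsum_lin _ _ hg).
by apply: eq_tsum => f e; rewrite (scalable_linear hg).
Qed.
End DualBasis.

Section ProjectiveModules.
Variable k : comPzRingType.
Implicit Types V W : lmodType k.

Lemma db_std_1 V : db_std V 1 = dual_basis V.
Proof. exact: scale1r. Qed.

Lemma transpose_linear V W (f : {linear V -> W}) :
  linear (transpose f : dual W -> dual V).
Proof. by move=> a p q; apply: dual_ext. Qed.

Lemma fg_projective_iso V W (f : lin_iso V W) : fg_projective V -> fg_projective W.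
Proof.
move=> [[n [e gen]] proj]; split.
  exists n, (fun j => f (e j)) => w; have [c ec] := gen (iso_inv f w); exists c.
  by rewrite -{1}(iso_invK f w) ec linear_sum; apply: eq_bigr => j _; rewrite linearZ.
move=> A B p g p_surj; have [h hP] := proj A B p (g \o f) p_surj.
by exists (h \o iso_inv f) => w /=; rewrite hP /= iso_invK.
Qed.

End ProjectiveModules.

(** * Comodules and comodule maps *)

Section ComoduleMaps.
Variables (k : comPzRingType) (H : coquasi_bialgebra k).
Implicit Types U V W Z : lmodType k.

Lemma comodule_map_comp U V W (dU : U -> H ⨂ U) (dV : V -> H ⨂ V) (dW : W -> H ⨂ W)
    (g : {linear V -> W}) (f : {linear U -> V}) :
  comodule_map dV dW g -> comodule_map dU dV f -> comodule_map dU dW (g \o f).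
Proof.
move=> hg hf u /=; rewrite hg hf tsum_bind //.
by prove_linear.
Qed.

Lemma id_comodule_map V (dV : {linear V -> H ⨂ V}) : comodule_map dV dV idfun.
Proof. by move=> v; rewrite /= tsum_tens. Qed.

Lemma comodule_map_iso V W (dV : V -> H ⨂ V) (dW : W -> H ⨂ W) (f : lin_iso V W) :
  comodule_map dV dW f -> comodule_map dW dV (iso_inv f).
Proof.
move=> hf w; rewrite -{2}(iso_invK f w) hf tsum_bind; last by prove_linear.
by under eq_tsum => a v do rewrite iso_funK; rewrite tsum_tens.
Qed.

Lemma tensor_coact_tens V W (dV : {linear V -> H ⨂ V}) (dW : {linear W -> H ⨂ W}) v w :
  tensor_coact dV dW (v ⊗ w) =
  \tsum_(a, v0 <- dV v) \tsum_(b, w0 <- dW w) (a *h b) ⊗ (v0 ⊗ w0).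
Proof. by rewrite /tensor_coact tliftE //; prove_linear. Qed.

Lemma tensor_coact_linear V W (dV : {linear V -> H ⨂ V}) (dW : {linear W -> H ⨂ W}) :
  linear (tensor_coact dV dW).
Proof. by apply: tlift_linear; prove_linear. Qed.

Lemma comodule_map_tensor V W Z (dV : {linear V -> H ⨂ V}) (dW : {linear W -> H ⨂ W})
    (dZ : {linear Z -> H ⨂ Z}) (f : {linear V ⨂ W -> Z}) :
  (forall v w, dZ (f (v ⊗ w)) =
    \tsum_(a, v0 <- dV v) \tsum_(b, w0 <- dW w) (a *h b) ⊗ f (v0 ⊗ w0)) ->
  comodule_map (tensor_coact dV dW) dZ f.
Proof.
move=> hf; apply: tensor_ext_lin; first by prove_linear.
  apply: lin_tsum_arg; first by prove_linear.
  exact: tensor_coact_linear.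
move=> v w; rewrite hf tensor_coact_tens tsum_tsum; last by prove_linear.
apply: eq_tsum => a v0; rewrite tsum_bind //; prove_linear.
Qed.

Lemma comodule_map_tmap V V' W W' (dV : {linear V -> H ⨂ V}) (dW : {linear W -> H ⨂ W})
    (dV' : {linear V' -> H ⨂ V'}) (dW' : {linear W' -> H ⨂ W'})
    (f : {linear V -> V'}) (g : {linear W -> W'}) :
  comodule_map dV dV' f -> comodule_map dW dW' g ->
  comodule_map (tensor_coact dV dW) (tensor_coact dV' dW') (tmap f g).
Proof.
move=> hf hg t; pose d : {linear V' ⨂ W' -> H ⨂ (V' ⨂ W')} := HB.pack_for
  {linear V' ⨂ W' -> H ⨂ (V' ⨂ W')} (tensor_coact dV' dW')
  (GRing.isLinear.Build k (V' ⨂ W') (H ⨂ (V' ⨂ W')) _ _ (tensor_coact_linear dV' dW')).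
apply: (@comodule_map_tensor _ _ _ _ _ d (tmap f g)) => v w /=.
rewrite tmap_tens tensor_coact_tens hf tsum_bind; last by prove_linear.
apply: eq_tsum => a v0; rewrite hg tsum_bind; last by prove_linear.
by apply: eq_tsum => b w0; rewrite tmap_tens.
Qed.

(** Coassociativity in Sweedler form, for an expression that is linear in each of
    the three factors. *)
Lemma comodule_coassoc V W (dV : {linear V -> H ⨂ V}) (f : H -> H -> V -> W) v :
  left_comodule dV ->
  (forall b v, linear (fun a => f a b v)) -> (forall a, bilinear_map (f a)) ->
  \tsum_(a, v0 <- dV v) \tsum_(b, v1 <- dV v0) f a b v1 =
  \tsum_(a, v0 <- dV v) \sw_(a1, a2 <- a) f a1 a2 v0.
Proof.
move=> [co _] hf1 hf2.
pose h (t : H ⨂ (H ⨂ V)) := \tsum_(a, t' <- t) \tsum_(b, v <- t') f a b v.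
have h_bil : bilinear_map (fun a t' => tsum t' (f a)).
  split=> [t'|a]; first exact: lin_tsum_body.
  by apply: lin_tsum_arg => //; apply: lin_id.
have h_lin : linear h by apply: lin_tsum_arg => //; apply: lin_id.
have h_tens a b w : h (a ⊗ (b ⊗ w)) = f a b w by rewrite /h !tliftE.
have := congr1 h (co v); rewrite !(tsum_lin _ _ h_lin).
under eq_tsum do (rewrite (tsum_lin _ _ h_lin); under eq_tsum do rewrite h_tens).
move=> ->; apply: eq_tsum => a v0; rewrite (tsum_lin _ _ h_lin).
by apply: eq_tsum => b v1; rewrite h_tens.
Qed.

Lemma comodule_counit V W (dV : {linear V -> H ⨂ V}) (g : V -> W) v :
  left_comodule dV -> linear g -> \tsum_(a, v0 <- dV v) (eps a : k) *: g v0 = g v.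
Proof.
move=> [_ cu] hg; rewrite -{2}(cu v) (tsum_lin _ _ hg).
by apply: eq_tsum => a v0; rewrite (scalable_linear hg).
Qed.

(** Coassociativity on the three factors gathers the two coefficients into the
    convolution product of omega_inv and omega, which is trivial. The exchanges
    only bring the successive coactions on the same factor next to each other. *)
Lemma omega_inv_omega_coact U V W Z (dU : {linear U -> H ⨂ U}) (dV : {linear V -> H ⨂ V})
    (dW : {linear W -> H ⨂ W}) (g : U -> V -> W -> Z) u v w :
  left_comodule dU -> left_comodule dV -> left_comodule dW ->
  (forall v w, linear (fun u => g u v w)) -> (forall u w, linear (fun v => g u v w)) ->
  (forall u v, linear (fun w => g u v w)) ->
  \tsum_(a, u0 <- dU u) \tsum_(b, v0 <- dV v) \tsum_(c, w0 <- dW w)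
    \tsum_(a', u1 <- dU u0) \tsum_(b', v1 <- dV v0) \tsum_(c', w1 <- dW w0)
      omega_inv a b c *: (omega a' b' c' *: g u1 v1 w1) = g u v w.
Proof.
move=> cU cV cW gU gV gW.
under eq_tsum => a u0.
  under eq_tsum => b v0.
    rewrite tsum_exchange; under eq_tsum => a' u1.
      rewrite tsum_exchange; under eq_tsum => b' v1.
        rewrite comodule_coassoc; [|done|by prove_linear|by prove_linear].
        over.
      over.
    over.
  rewrite tsum_exchange; under eq_tsum => a' u1.
    rewrite comodule_coassoc; [|done|by prove_linear|by prove_linear].
    over.
  over.
rewrite comodule_coassoc; [|done|by prove_linear|by prove_linear].
under eq_tsum => a u0.
  rewrite tsum_exchange; under eq_tsum => b v0.
    under eq_tsum do rewrite tsum_exchange.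
    rewrite tsum_exchange; under eq_tsum => c w0.
      under eq_tsum do under eq_tsum do
        (under eq_tsum do rewrite scalerA; rewrite tsum_scalel).
      under eq_tsum do rewrite tsum_scalel.
      rewrite tsum_scalel (omega_convl (cqb_axioms H)) -scalerA.
      over.
    rewrite tsumZ comodule_counit // -scalerA; over.
  rewrite tsumZ comodule_counit //; over.
by rewrite comodule_counit.
Qed.

Lemma left_comodule_iso V W (dV : {linear V -> H ⨂ V}) (f : lin_iso V W) :
  left_comodule dV -> left_comodule (tmap idfun f \o dV \o iso_inv f).
Proof.
move=> [co cu]; split=> w /=; rewrite tsum_tmap; try by prove_linear.
  rewrite [RHS]tsum_tmap; last by prove_linear.
  under [RHS]eq_tsum => a v do
    (rewrite iso_funK tsum_tmap; last by prove_linear).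
  have := congr1 (tmap idfun (tmap idfun f)) (co (iso_inv f w)).
  rewrite !tmap_tsum; under eq_tsum do rewrite tmap_tsum.
  (under eq_tsum do under eq_tsum do rewrite tmap_tens /= tmap_tens /=) => /= ->.
  apply: eq_tsum => a v; rewrite tmap_tsum; apply: eq_tsum => b v0.
  by rewrite tmap_tens /= tmap_tens.
rewrite -{2}(iso_invK f w) -{2}(cu (iso_inv f w)) tsum_lin; last exact: linearP.
by apply: eq_tsum => a v; rewrite linearZ.
Qed.
End ComoduleMaps.

(** * Coefficients of the coendomorphism bialgebra *)

Section Coendomorphism.
Variables (k : comPzRingType) (C : monoidal) (F : quasi_monoidal_functor k C).
Variables (H : coquasi_bialgebra k).
Variable i : forall X : C, {linear F X ⨂ dual (F X) -> H}.
Hypothesis H_coend : coendomorphism_bialgebra i.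

(* The class of x ⊗ psi in H, a matrix coefficient of the coaction on F X. *)
Local Notation coef x psi := (i _ (x ⊗ psi)).

Lemma coef_natural X Y (f : hom X Y) (x : F X) (psi : linear_form (F Y)) :
  coef x (transpose (fmap F f) psi) = coef (fmap F f x) psi.
Proof. exact: (ceb_coend H_coend).1. Qed.

(** The uniqueness half of the universal property: H is spanned by coefficients. *)
Lemma coend_ext (V : lmodType k) (g g' : {linear H -> V}) :
  (forall X (x : F X) (psi : linear_form (F X)), g (coef x psi) = g' (coef x psi)) -> g =1 g'.
Proof.
move=> e; have [|h [_ hu]] := (ceb_coend H_coend).2 V (fun X => g \o i X).
  by move=> X Y f x psi /=; rewrite (ceb_coend H_coend).1.
have hg : g =1 h by apply: hu.
have hg' : g' =1 h.
  apply: hu => X; apply: (@tensor_ext_lin _ _ _ _ (fun t => g' (i X t)) (fun t => g (i X t))).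
  - by prove_linear.
  - by prove_linear.
  - by move=> x psi; rewrite -[LHS]e.
by move=> a; rewrite hg hg'.
Qed.

Lemma coend_ext_lin (V : lmodType k) (f g : H -> V) : linear f -> linear g ->
  (forall X (x : F X) (psi : linear_form (F X)), f (coef x psi) = g (coef x psi)) -> f =1 g.
Proof.
move=> hf hg e.
pose f' : {linear H -> V} := HB.pack_for {linear H -> V} f (GRing.isLinear.Build k H V _ f hf).
pose g' : {linear H -> V} := HB.pack_for {linear H -> V} g (GRing.isLinear.Build k H V _ g hg).
exact: (@coend_ext V f' g').
Qed.

Lemma coend_lift (V : lmodType k) (b : forall X, F X -> dual (F X) -> V) :
  (forall X, bilinear_map (@b X)) ->
  (forall X Y (f : hom X Y) x psi,
     b X x (transpose (fmap F f) psi) = b Y (fmap F f x) psi) ->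
  exists g : {linear H -> V}, forall X (x : F X) (psi : linear_form (F X)),
    g (coef x psi) = b X x psi.
Proof.
move=> b_bil b_nat.
have [|g [gP _]] := (ceb_coend H_coend).2 V (fun X => tlift (b_bil X)).
  by move=> X Y f x psi; rewrite !tliftP.
by exists g => X x psi; rewrite gP tliftP.
Qed.

Lemma coact_comodule X : left_comodule (@coact k C F H i X : {linear _ -> _}).
Proof. exact: ceb_comodule. Qed.

Lemma tsum_coact X (x : F X) (W : lmodType k) (f : H -> F X -> W) : bilinear_map f ->
  tsum (coact i x) f = \tsum_(q, e <- dual_basis (F X)) f (coef x q) e.
Proof. by move=> hf; rewrite /coact tsum_bind. Qed.

(** Applying a form psi to the comodule leg of the coaction of x gives the
    coefficient of x and psi. *)
Lemma tsum_coact_form X (x : F X) (W : lmodType k) (f : H -> W) (psi : linear_form (F X)) :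
  linear f -> \tsum_(a, x0 <- coact i x) (psi x0 : k) *: f a = f (coef x psi).
Proof.
move=> hf; rewrite tsum_coact; last by prove_linear.
apply: (@dual_basis_form _ _ (fob_fgp F X) _ (fun q => f (coef x q))); prove_linear.
Qed.

Lemma tmap_coact (V : lmodType k) (g : {linear H -> V}) X (x : F X) :
  tmap g idfun (coact i x) = \tsum_(q, e <- dual_basis (F X)) g (coef x q) ⊗ e.
Proof. exact: tmap_tsum_tens. Qed.

(** The defining equations of alpha, beta and s all prescribe the left-hand side
    of this hypothesis, whence their uniqueness. *)
Lemma coact_separates (V : lmodType k) (g g' : {linear H -> V}) :
  (forall X (x : F X), tmap g idfun (coact i x) = tmap g' idfun (coact i x)) -> g =1 g'.
Proof.
move=> e; apply: (coend_ext) => X x psi.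
have := congr1 (fun t => \tsum_(w, v <- t) (psi v : k) *: w) (e X x).
rewrite !tsum_tmap; try by prove_linear.
by rewrite !tsum_coact_form //; prove_linear.
Qed.

(** Comatrix comultiplication: coassociativity of the coaction, with psi applied
    to the comodule leg. *)
Lemma coef_Delta X (x : F X) psi :
  Delta (coef x psi) = \tsum_(q, e <- dual_basis (F X)) coef x q ⊗ coef e psi.
Proof.
have [co _] := coact_comodule X.
pose h (t : H ⨂ (H ⨂ F X)) := \tsum_(a, t' <- t) \tsum_(b, v <- t') (psi v : k) *: (a ⊗ b).
have h_lin : linear h by rewrite /h; prove_linear.
have h_tens a b v : h (a ⊗ (b ⊗ v)) = (psi v : k) *: (a ⊗ b).
  by rewrite /h !tliftE //; prove_linear.
have := congr1 h (co x); rewrite !(tsum_lin _ _ h_lin).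
under eq_tsum do
  (rewrite (tsum_lin _ _ h_lin); under eq_tsum do rewrite h_tens; rewrite tsumZ tsum_tens).
under [X in _ = X -> _]eq_tsum do (rewrite (tsum_lin _ _ h_lin); under eq_tsum do rewrite h_tens).
rewrite tsum_coact_form; last exact: linearP.
move=> ->; rewrite tsum_coact; last by prove_linear.
apply: eq_tsum => q e; rewrite tsum_coact_form //; prove_linear.
Qed.

Lemma tsum_Delta_coef X (x : F X) (psi : linear_form (F X)) (W : lmodType k) (f : H -> H -> W) :
  bilinear_map f ->
  tsum (Delta (coef x psi)) f = \tsum_(q, e <- dual_basis (F X)) f (coef x q) (coef e psi).
Proof. by move=> hf; rewrite coef_Delta tsum_bind. Qed.

Lemma coef_eps X (x : F X) (psi : linear_form (F X)) : eps (coef x psi) = psi x.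
Proof.
have [_ cu] := coact_comodule X; rewrite -{2}(cu x) tsum_lin; last exact: linearP.
rewrite -(@tsum_coact_form _ _ _ eps); last exact: linearP.
by apply: eq_tsum => a v; rewrite linearZ; apply: mulrC.
Qed.

(** In dual bases the claim says that the matrix of F f can be moved from one leg
    to the other, which is the defining relation of the coend. *)
Lemma coact_natural X Y (f : hom X Y) :
  comodule_map (@coact _ _ _ H i X) (@coact _ _ _ H i Y) (fmap F f).
Proof.
move=> x; rewrite tsum_coact; last by prove_linear.
rewrite /coact.
under eq_tsum => q e.
  rewrite -coef_natural -(@dual_basis_form _ _ (fob_fgp F X) _ (fun p => coef x p ⊗ e));
    last by prove_linear.
  over.
rewrite tsum_exchange; apply: eq_tsum => p e /=.
rewrite -(@dual_basis_vec _ _ (fob_fgp F Y) _ (fun e => coef x p ⊗ e)); last by prove_linear.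
done.
Qed.

Lemma coact_phi X Y : comodule_map
  (tensor_coact (@coact _ _ _ H i X) (@coact _ _ _ H i Y)) (@coact _ _ _ H i _) (phi F X Y).
Proof.
have := @comodule_map_tensor k H _ _ _ (@coact _ _ _ H i X) (@coact _ _ _ H i Y)
  (@coact _ _ _ H i _) (phi F X Y).
apply=> x y /=; exact/esym/(ceb_mul H_coend).
Qed.

Lemma phi0_scale (c : k^o) : phi0 F c = (c : k) *: phi0 F 1.
Proof. by rewrite -linearZ /= /GRing.scale /= mulr1. Qed.

Lemma coact_phi0 : comodule_map (@unit_coact k H) (@coact _ _ _ H i _) (phi0 F).
Proof.
move=> c; rewrite /unit_coact tliftE; last by prove_linear.
by rewrite phi0_scale linearZ /= -(ceb_unit H_coend) tensZr.
Qed.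

(** omega computes F(a^-1); since omega_inv is its convolution inverse, it
    computes F(a). *)
Lemma omega_inv_coact X Y Z (x : F X) (y : F Y) (z : F Z) :
  \tsum_(a, x0 <- coact i x) \tsum_(b, y0 <- coact i y) \tsum_(c, z0 <- coact i z)
    omega_inv a b c *: phi F X (Y ⊠ Z)%cat (x0 ⊗ phi F Y Z (y0 ⊗ z0)) =
  fmap F (assoc X Y Z) (phi F (X ⊠ Y)%cat Z (phi F X Y (x ⊗ y) ⊗ z)).
Proof.
pose A := fmap F (assoc_inv X Y Z).
have AK u : fmap F (assoc X Y Z) (A u) = u by rewrite -fmap_comp assocVK fmap_id.
have A_lin : linear A by prove_linear.
rewrite -[LHS]AK; congr (fmap F _ _).
rewrite (tsum_lin _ _ A_lin); under eq_tsum => a x0.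
  rewrite (tsum_lin _ _ A_lin); under eq_tsum => b y0.
    rewrite (tsum_lin _ _ A_lin); under eq_tsum => c z0.
      rewrite (scalable_linear A_lin) /= /A -(ceb_omega H_coend) -tsumZ; under eq_tsum => a' x1.
        rewrite -tsumZ; under eq_tsum => b' y1 do rewrite -tsumZ.
        over.
      over.
    over.
  over.
rewrite /= (@omega_inv_omega_coact _ _ _ _ _ _
  (@coact _ _ _ H i X) (@coact _ _ _ H i Y) (@coact _ _ _ H i Z)
  (fun x y z => phi F (X ⊠ Y)%cat Z (phi F X Y (x ⊗ y) ⊗ z))) //.
all: by [apply: coact_comodule | prove_linear].
Qed.

End Coendomorphism.

(** * The dual comodule of F X *)

Section Duals.
Variables (k : comPzRingType) (C : monoidal) (D : right_duals C).
Variables (F : quasi_monoidal_functor k C) (F_neutral : neutral F).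
Variables (H : coquasi_bialgebra k).
Variable i : forall X : C, {linear F X ⨂ dual (F X) -> H}.
Hypothesis H_coend : coendomorphism_bialgebra i.
Variable nu : forall X : C, lin_iso (F (rdual D X)) (dual (F X)).

Local Notation coef x psi := (i _ (x ⊗ psi)).
Local Notation "'δ' X" := (@coact k C F H i X) (at level 10, X at level 9).
Local Notation "X ^⋆" := (rdual D X) (at level 2, format "X ^⋆").
Local Notation coact_dual := (coact_dual nu i).

Lemma nu_comodule_map X : comodule_map (δ (X^⋆)) (coact_dual X) (nu X).
Proof. by move=> y /=; rewrite iso_funK. Qed.

Lemma nu_inv_comodule_map X : comodule_map (coact_dual X) (δ (X^⋆)) (iso_inv (nu X)).
Proof. exact/comodule_map_iso/nu_comodule_map. Qed.

Lemma coact_dual_comodule X : left_comodule (coact_dual X).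
Proof. exact/left_comodule_iso/coact_comodule. Qed.

Lemma ev_F_comodule_map X :
  comodule_map (tensor_coact (δ X) (δ (X^⋆))) (@unit_coact k H) (ev_F F D X).
Proof.
apply: comodule_map_comp; last exact: (coact_phi H_coend).
apply: comodule_map_comp; last exact: (coact_natural H_coend).
exact/comodule_map_iso/coact_phi0.
Qed.

Lemma db_F_comodule_map X :
  comodule_map (@unit_coact k H) (tensor_coact (δ (X^⋆)) (δ X)) (db_F F D X).
Proof.
apply: comodule_map_comp; last exact: (coact_phi0 H_coend).
apply: comodule_map_comp; last exact: (coact_natural H_coend).
exact/comodule_map_iso/(coact_phi H_coend).
Qed.

Lemma ev_star_comodule_map X :
  comodule_map (tensor_coact (δ X) (coact_dual X)) (@unit_coact k H) (ev_star nu X).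
Proof.
apply: comodule_map_comp; first exact: ev_F_comodule_map.
apply: comodule_map_tmap; first exact: id_comodule_map.
exact: nu_inv_comodule_map.
Qed.

Lemma db_star_comodule_map X :
  comodule_map (@unit_coact k H) (tensor_coact (coact_dual X) (δ X)) (db_star nu X).
Proof.
apply: comodule_map_comp; last exact: db_F_comodule_map.
apply: comodule_map_tmap; first exact: nu_comodule_map.
exact: id_comodule_map.
Qed.

Lemma ev_star_nu X (x : F X) (y : F (X^⋆)) : ev_star nu X (x ⊗ nu X y) = ev_F F D X (x ⊗ y).
Proof. by rewrite /= tmap_tens iso_funK. Qed.

(** Neutrality turns the unit constraint of C into that of modules. *)
Lemma phi_ev_F X (Y : C) (x : F X) (x' : F (X^⋆)) (y : F Y) :
  fmap F (lunit Y) (fmap F (ev D X ⊠m idm Y)%cat (phi F _ _ (phi F _ _ (x ⊗ x') ⊗ y))) =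
  (ev_F F D X (x ⊗ x') : k) *: y.
Proof.
rewrite -phi_nat tmap_tens fmap_id -(iso_invK (phi0 F) (fmap _ _ _)).
by rewrite (F_neutral _ _).1.
Qed.

Lemma phi_ev_F_r X (Y : C) (x : F X) (x' : F (X^⋆)) (y : F Y) :
  fmap F (runit Y) (fmap F (idm Y ⊠m ev D X)%cat (phi F _ _ (y ⊗ phi F _ _ (x ⊗ x')))) =
  (ev_F F D X (x ⊗ x') : k) *: y.
Proof.
rewrite -phi_nat tmap_tens fmap_id -(iso_invK (phi0 F) (fmap _ _ _)).
by rewrite (F_neutral _ _).2.
Qed.

Lemma phi_db_F X : phi F _ _ (db_F F D X 1) = fmap F (db D X) (phi0 F 1).
Proof. by rewrite /= iso_invK. Qed.

Lemma phi_unitr X (x : F X) : phi F _ _ (x ⊗ phi0 F 1) = fmap F (runit_inv X) x.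
Proof.
rewrite -[LHS]fmap_id -runitK fmap_comp (F_neutral _ _).2 scale1r //.
Qed.

Lemma phi_unitl X (x : F X) : phi F _ _ (phi0 F 1 ⊗ x) = fmap F (lunit_inv X) x.
Proof.
rewrite -[LHS]fmap_id -lunitK fmap_comp (F_neutral _ _).1 scale1r //.
Qed.

(** The reassociated evaluation is the image under F of the corresponding morphism of C,
    because omega implements F(a^-1). *)
Lemma omega_ev_F X Y (x : F X) (x' : F (X^⋆)) (y : F Y) :
  \tsum_(a, x0 <- δ X x) \tsum_(b, x'0 <- δ (X^⋆) x') \tsum_(c, y0 <- δ Y y)
    (omega a b c * ev_F F D X (x0 ⊗ x'0) : k) *: y0 =
  fmap F (lunit Y ∘ (ev D X ⊠m idm Y) ∘ assoc_inv X X^⋆ Y)%cat (phi F _ _ (x ⊗ phi F _ _ (x' ⊗ y))).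
Proof.
rewrite fmap_comp -(ceb_omega H_coend).
pose L u := fmap F (lunit Y ∘ (ev D X ⊠m idm Y))%cat u.
have L_lin : linear L by prove_linear.
rewrite -/(L _) (tsum_lin _ _ L_lin); apply: eq_tsum => a x0.
rewrite (tsum_lin _ _ L_lin); apply: eq_tsum => b x'0.
rewrite (tsum_lin _ _ L_lin); apply: eq_tsum => c y0.
by rewrite (scalable_linear L_lin) /= /L fmap_comp phi_ev_F scalerA.
Qed.

Lemma omega_inv_ev_F X Y (y : F Y) (x : F X) (x' : F (X^⋆)) :
  \tsum_(a, y0 <- δ Y y) \tsum_(b, x0 <- δ X x) \tsum_(c, x'0 <- δ (X^⋆) x')
    (omega_inv a b c * ev_F F D X (x0 ⊗ x'0) : k) *: y0 =
  fmap F (runit Y ∘ (idm Y ⊠m ev D X) ∘ assoc Y X X^⋆)%cat (phi F _ _ (phi F _ _ (y ⊗ x) ⊗ x')).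
Proof.
rewrite fmap_comp -(omega_inv_coact H_coend).
pose L u := fmap F (runit Y ∘ (idm Y ⊠m ev D X))%cat u.
have L_lin : linear L by prove_linear.
rewrite -/(L _) (tsum_lin _ _ L_lin); apply: eq_tsum => a y0.
rewrite (tsum_lin _ _ L_lin); apply: eq_tsum => b x0.
rewrite (tsum_lin _ _ L_lin); apply: eq_tsum => c x'0.
by rewrite (scalable_linear L_lin) /= /L fmap_comp phi_ev_F_r scalerA.
Qed.

(** The image under F of the zigzag identity of X. *)
Lemma ev_db_F X (x : F X) :
  \tsum_(y, v <- db_F F D X 1) \tsum_(a, x0 <- δ X x) \tsum_(b, y0 <- δ (X^⋆) y)
    \tsum_(c, v0 <- δ X v) (omega a b c * ev_F F D X (x0 ⊗ y0) : k) *: v0 = x.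
Proof.
under eq_tsum do rewrite omega_ev_F.
pose L t := fmap F (lunit X ∘ (ev D X ⊠m idm X) ∘ assoc_inv X X^⋆ X)%cat
  (phi F _ _ (x ⊗ phi F _ _ t)).
have L_lin : linear L by prove_linear.
transitivity (L (db_F F D X 1)).
  by rewrite -{2}[db_F F D X 1]tsum_tens (tsum_lin _ _ L_lin).
rewrite /L phi_db_F -[in X in phi F _ _ X](fmap_id x).
have <- := tmap_tens (fmap F (idm X)) (fmap F (db D X)).
by rewrite phi_nat phi_unitr -!fmap_comp rdual_zigzag fmap_id.
Qed.

(** The image under F of the other zigzag identity. *)
Lemma db_ev_F X (x' : F (X^⋆)) :
  \tsum_(y, v <- db_F F D X 1) \tsum_(a, y0 <- δ (X^⋆) y) \tsum_(b, v0 <- δ X v)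
    \tsum_(c, x'0 <- δ (X^⋆) x') (omega_inv a b c * ev_F F D X (v0 ⊗ x'0) : k) *: y0 = x'.
Proof.
under eq_tsum do rewrite omega_inv_ev_F.
pose L t := fmap F (runit (X^⋆) ∘ (idm (X^⋆) ⊠m ev D X) ∘ assoc (X^⋆) X X^⋆)%cat
  (phi F _ _ (phi F _ _ t ⊗ x')).
have L_lin : linear L by prove_linear.
transitivity (L (db_F F D X 1)).
  by rewrite -{2}[db_F F D X 1]tsum_tens (tsum_lin _ _ L_lin).
rewrite /L phi_db_F -[in X in phi F _ _ X](fmap_id x').
have <- := tmap_tens (fmap F (db D X)) (fmap F (idm X^⋆)).
by rewrite phi_nat phi_unitl -!fmap_comp rdual_zagzig fmap_id.
Qed.

Lemma db_star_tsum X (W : lmodType k) (f : dual (F X) -> F X -> W) : bilinear_map f ->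
  tsum (db_star nu X 1) f = \tsum_(y, v <- db_F F D X 1) f (nu X y) v.
Proof. exact: tsum_tmap. Qed.

Lemma coact_dual_nu_tsum X (y : F X^⋆) (W : lmodType k) (f : H -> dual (F X) -> W) :
  bilinear_map f -> tsum (coact_dual X (nu X y)) f = \tsum_(a, y0 <- δ (X^⋆) y) f a (nu X y0).
Proof. by move=> hf; rewrite nu_comodule_map tsum_bind. Qed.

Lemma ev_db_star X (x : F X) :
  \tsum_(f, v <- db_star nu X 1) \tsum_(a, x0 <- δ X x) \tsum_(b, f0 <- coact_dual X f)
    \tsum_(c, v0 <- δ X v) (omega a b c * ev_star nu X (x0 ⊗ f0) : k) *: v0 = x.
Proof.
rewrite -[RHS]ev_db_F db_star_tsum; last by prove_linear.
apply: eq_tsum => y v; apply: eq_tsum => a x0.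
rewrite coact_dual_nu_tsum; last by prove_linear.
by apply: eq_tsum => b y0; apply: eq_tsum => c v0; rewrite ev_star_nu.
Qed.

Lemma db_ev_star X (f : linear_form (F X)) :
  \tsum_(f', v <- db_star nu X 1) \tsum_(a, f0 <- coact_dual X f') \tsum_(b, v0 <- δ X v)
    \tsum_(c, g0 <- coact_dual X f) (omega_inv a b c * ev_star nu X (v0 ⊗ g0) : k) *: f0 = f.
Proof.
rewrite -[RHS](iso_invK (nu X)) -[in RHS](db_ev_F (iso_inv (nu X) f)) db_star_tsum;
  last by prove_linear.
rewrite (tsum_lin _ _ (linearP (nu X))); apply: eq_tsum => y v.
rewrite coact_dual_nu_tsum; last by prove_linear.
rewrite (tsum_lin _ _ (linearP (nu X))); apply: eq_tsum => a y0.
rewrite (tsum_lin _ _ (linearP (nu X))); apply: eq_tsum => b v0.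
rewrite (tsum_lin _ _ (linearP (nu X))) -{1}(iso_invK (nu X) f) coact_dual_nu_tsum;
  last by prove_linear.
by apply: eq_tsum => c y1; rewrite ev_star_nu linearZ.
Qed.

Lemma comod_right_dual_star X :
  comod_right_dual (δ X : {linear F X -> H ⨂ F X}) (coact_dual X) (ev_star nu X) (db_star nu X).
Proof.
split.
- exact: fob_fgp.
- exact/(fg_projective_iso (nu X))/fob_fgp.
- exact: coact_comodule.
- exact: coact_dual_comodule.
- exact: ev_star_comodule_map.
- exact: db_star_comodule_map.
- move=> x; rewrite tmap_tens /comod_assoc_inv tliftE; last by prove_linear.
  pose K t := klunit (tmap (ev_star nu X) (@idfun (F X)) t).
  have K_lin : linear K by rewrite /K /klunit; prove_linear.
  have K_tens y f v : K (y ⊗ f ⊗ v) = (ev_star nu X (y ⊗ f) : k) *: v.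
    by rewrite /K tmap_tens /klunit tliftE //; prove_linear.
  rewrite -/(K _) (tsum_lin _ _ K_lin) -{2}(ev_db_star x).
  apply: eq_tsum => f v; rewrite (tsum_lin _ _ K_lin); apply: eq_tsum => a x0.
  rewrite (tsum_lin _ _ K_lin); apply: eq_tsum => b f0.
  rewrite (tsum_lin _ _ K_lin); apply: eq_tsum => c v0.
  by rewrite (scalable_linear K_lin) /= K_tens scalerA.
- move=> f; rewrite tmap_tens /comod_assoc tliftE; last by prove_linear.
  pose K t := krunit (tmap (@idfun (dual (F X))) (ev_star nu X) t).
  have K_lin : linear K by rewrite /K /krunit; prove_linear.
  have K_tens (g : dual (F X)) y h : K (g ⊗ (y ⊗ h)) = (ev_star nu X (y ⊗ h) : k) *: g.
    by rewrite /K tmap_tens /krunit tliftE //; prove_linear.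
  rewrite -/(K _) (tsum_lin _ _ K_lin) -{2}(db_ev_star f).
  apply: eq_tsum => f' v; rewrite (tsum_lin _ _ K_lin); apply: eq_tsum => a f0.
  rewrite (tsum_lin _ _ K_lin); apply: eq_tsum => b v0.
  rewrite (tsum_lin _ _ K_lin); apply: eq_tsum => c g0.
  by rewrite (scalable_linear K_lin) /= K_tens scalerA.
Qed.

End Duals.

(** * Existence of alpha, beta and s *)

Section Antipode.
Variables (k : comPzRingType) (C : monoidal) (D : right_duals C).
Variable F : quasi_monoidal_functor k C.
Variables (H : coquasi_bialgebra k).
Variable i : forall X : C, {linear F X ⨂ dual (F X) -> H}.
Hypothesis H_coend : coendomorphism_bialgebra i.
Variable nu : forall X : C, lin_iso (F (rdual D X)) (dual (F X)).
Hypothesis nu_natural : dual_natural nu.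

Local Notation coef x psi := (i _ (x ⊗ psi)).
Local Notation "'δ' X" := (@coact k C F H i X) (at level 10, X at level 9).
Local Notation "X ^⋆" := (rdual D X) (at level 2, format "X ^⋆").
Local Notation coact_dual := (coact_dual nu i).

Fact eval_nu_linear X (x : F X) : linear (fun y => nu X y x : k^o).
Proof. by prove_linear. Qed.
(** The form on F(X^⋆) that corresponds under nu to evaluation at x. *)
Definition eval_nu X (x : F X) : linear_form (F X^⋆) := to_dual (eval_nu_linear x).

Lemma eval_nu_linear_l X : linear (@eval_nu X : F X -> dual (F X^⋆)).
Proof. by move=> a x y; apply: dual_ext => z; rewrite /= linearP. Qed.

Lemma nu_inv_natural X Y (f : hom X Y) (psi : linear_form (F Y)) :
  iso_inv (nu X) (transpose (fmap F f) psi) = fmap F (rdual_mor D f) (iso_inv (nu Y) psi).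
Proof.
rewrite -[RHS](iso_funK (nu X)) (nu_natural (rdual_morP D f)); congr (iso_inv _ _).
by rewrite iso_invK.
Qed.

Lemma ev_star_natural X Y (f : hom X Y) (x : F X) (psi : linear_form (F Y)) :
  ev_star nu X (x ⊗ transpose (fmap F f) psi) = ev_star nu Y (fmap F f x ⊗ psi).
Proof.
rewrite /= !tmap_tens nu_inv_natural /=.
have eqX (y : F Y^⋆) := tmap_tens (fmap F (idm X)) (fmap F (rdual_mor D f)) x y.
have eqY (y : F Y^⋆) := tmap_tens (fmap F f) (fmap F (idm Y^⋆)) x y.
rewrite -[in LHS](fmap_id x) -eqX phi_nat -[in RHS](fmap_id (iso_inv _ _)) -eqY phi_nat.
by rewrite -!fmap_comp rdual_morP.
Qed.

Lemma db_F_natural X Y (f : hom X Y) :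
  tmap idfun (fmap F f) (db_F F D X 1) = tmap (fmap F (rdual_mor D f)) idfun (db_F F D Y 1).
Proof.
have -> : tmap idfun (fmap F f) (db_F F D X 1) = tmap (fmap F (idm X^⋆)) (fmap F f) (db_F F D X 1).
  by apply: eq_tsum => u v; rewrite fmap_id.
have -> : tmap (fmap F (rdual_mor D f)) idfun (db_F F D Y 1) =
    tmap (fmap F (rdual_mor D f)) (fmap F (idm Y)) (db_F F D Y 1).
  by apply: eq_tsum => u v; rewrite fmap_id.
rewrite -[LHS](iso_funK (phi F _ _)) -[RHS](iso_funK (phi F _ _)); congr (iso_inv _ _).
by rewrite !phi_nat !phi_db_F -!fmap_comp db_rdual_mor.
Qed.

(** The dinaturality of db, transported along phi and nu. *)
Lemma db_star_natural X Y (f : hom X Y) (W : lmodType k) (g : dual (F X) -> F Y -> W) :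
  bilinear_map g ->
  \tsum_(f', v <- db_star nu X 1) g f' (fmap F f v) =
  \tsum_(f', v <- db_star nu Y 1) g (transpose (fmap F f) f') v.
Proof.
move=> [gl gr]; have tl := transpose_linear (fmap F f).
rewrite db_star_tsum; last by prove_linear.
rewrite db_star_tsum; last by prove_linear.
have := congr1 (fun t => \tsum_(y, v <- t) g (nu X y) v) (db_F_natural f).
rewrite /= !tsum_tmap; try by prove_linear.
by move=> ->; apply: eq_tsum => y v; rewrite (nu_natural (rdual_morP D f)).
Qed.

(** The pairing of db^*(1) with x and psi is dinatural because db is. *)
Lemma alpha_exists : exists alpha : {linear H -> k^o}, forall X (x : F X) (psi : linear_form (F X)),
  alpha (coef x psi) = \tsum_(f, v <- db_star nu X 1) ((f : linear_form (F X)) x * psi v : k^o).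
Proof.
apply: (@coend_lift _ _ _ _ _ H_coend k^o (fun X x (psi : dual (F X)) =>
  \tsum_(f, v <- db_star nu X 1) ((f : linear_form (F X)) x * psi v : k^o))).
  by move=> X; prove_linear.
move=> X Y f x psi.
pose g (f' : dual (F X)) (v : F Y) : k^o := f' x * psi v.
by have := @db_star_natural _ _ f k^o g; rewrite /g => ->; last by prove_linear.
Qed.

Lemma beta_exists : exists beta : {linear H -> k^o}, forall X (x : F X) (psi : linear_form (F X)),
  beta (coef x psi) = ev_star nu X (x ⊗ psi).
Proof.
apply: (@coend_lift _ _ _ _ _ H_coend k^o (fun X x (psi : dual (F X)) => ev_star nu X (x ⊗ psi))).
  by move=> X; prove_linear.
exact: ev_star_natural.
Qed.

(** s exchanges the two legs of a coefficient of X, viewing the result as a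
    coefficient of X^⋆ through nu. *)
Lemma antipode_exists : exists s : {linear H -> H}, forall X (x : F X) (psi : linear_form (F X)),
  s (coef x psi) = coef (iso_inv (nu X) psi) (eval_nu x).
Proof.
apply: (@coend_lift _ _ _ _ _ H_coend H (fun X x (psi : dual (F X)) =>
  coef (iso_inv (nu X) psi) (eval_nu x))).
  by move=> X; have el := @eval_nu_linear_l X; prove_linear.
move=> X Y f x psi; rewrite nu_inv_natural -(coef_natural H_coend).
congr (coef _ _); apply: dual_ext => y /=.
by rewrite (nu_natural (rdual_morP D f)).
Qed.

End Antipode.

(** * The axioms of a coquasi-antipode *)

Section AntipodeAxioms.
Variables (k : comPzRingType) (C : monoidal) (D : right_duals C).
Variables (F : quasi_monoidal_functor k C) (F_neutral : neutral F).
Variables (H : coquasi_bialgebra k).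
Variable i : forall X : C, {linear F X ⨂ dual (F X) -> H}.
Hypothesis H_coend : coendomorphism_bialgebra i.
Variable nu : forall X : C, lin_iso (F (rdual D X)) (dual (F X)).

Local Notation coef x psi := (i _ (x ⊗ psi)).
Local Notation "'δ' X" := (@coact k C F H i X) (at level 10, X at level 9).
Local Notation "X ^⋆" := (rdual D X) (at level 2, format "X ^⋆").
Local Notation coact_dual := (coact_dual nu i).
Local Notation DB X := (dual_basis (F X)).

Variables (s : {linear H -> H}) (alpha beta : linear_form H).
Hypothesis sE : forall X (x : F X) (psi : linear_form (F X)),
  s (coef x psi) = coef (iso_inv (nu X) psi) (eval_nu nu x).
Hypothesis alphaE : forall X (x : F X) (psi : linear_form (F X)),
  alpha (coef x psi) = \tsum_(f, v <- db_star nu X 1) ((f : linear_form (F X)) x * psi v : k^o).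
Hypothesis betaE : forall X (x : F X) (psi : linear_form (F X)),
  beta (coef x psi) = ev_star nu X (x ⊗ psi).

(** A dual basis of F X expands the values of nu; the coordinate forms
    y |-> nu(y)(e) on F(X^⋆) are the ones that occur in s. *)
Lemma coact_dualE X (f : linear_form (F X)) :
  coact_dual X f = \tsum_(q, e <- DB X) s (coef e f) ⊗ q.
Proof.
have el := @eval_nu_linear_l _ _ _ _ nu X.
under eq_tsum => q e.
  rewrite sE -(@tsum_coact_form _ _ _ _ _ _ _ H (fun a => a)) //.
  rewrite -[_ ⊗ q]/((fun a => a ⊗ q) _) tsum_lin; last by prove_linear.
  under eq_tsum do rewrite tensZl.
  over.
rewrite tsum_exchange; apply: eq_tsum => a y /=.
by rewrite (@dual_basis_form _ _ (fob_fgp F X) _ (tens a)) //; prove_linear.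
Qed.

Lemma tsum_coact_dual X (f : linear_form (F X)) (W : lmodType k) (g : H -> dual (F X) -> W) :
  bilinear_map g -> tsum (coact_dual X f) g = \tsum_(q, e <- DB X) g (s (coef e f)) q.
Proof. by move=> hg; rewrite coact_dualE tsum_bind. Qed.

Lemma tsum_coact_dual_form X (f : linear_form (F X)) (x : F X) (W : lmodType k) (g : H -> W) :
  linear g ->
  \tsum_(a, f0 <- coact_dual X f) ((f0 : linear_form (F X)) x : k) *: g a = g (s (coef x f)).
Proof.
move=> hg; rewrite tsum_coact_dual; last by prove_linear.
by rewrite (@dual_basis_vec _ _ (fob_fgp F X) _ (fun e => g (s (coef e f)))) //; prove_linear.
Qed.

(** The values of alpha on coefficients are the coordinates of db^*(1) in a dual
    basis. *)
Lemma alpha_sum X (W : lmodType k) (g : dual (F X) -> F X -> W) : bilinear_map g ->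
  \tsum_(p, x <- DB X) \tsum_(q, y <- DB X) (alpha (coef x q) : k) *: g p y =
  tsum (db_star nu X 1) g.
Proof.
move=> [gl gr].
under eq_tsum => p x.
  under eq_tsum => q y.
    rewrite alphaE -tsum_scalel; under eq_tsum => f v do rewrite -scalerA.
    over.
  rewrite tsum_exchange; under eq_tsum => f v.
    rewrite tsumZ (@dual_basis_vec _ _ (fob_fgp F X) _ (g p)) //.
    over.
  over.
rewrite tsum_exchange; apply: eq_tsum => f v.
exact: (@dual_basis_form _ _ (fob_fgp F X) _ (fun p => g p v)).
Qed.

(** Both sides are the iterated coaction of psi in the dual comodule, evaluated
    at x. *)
Lemma s_Delta h : Delta (s h) = \sw_(h1, h2 <- h) s h2 ⊗ s h1.
Proof.
move: h; apply: (coend_ext_lin H_coend); [by prove_linear | by prove_linear |] => X x psi.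
rewrite sE (coef_Delta H_coend) (tsum_Delta_coef H_coend); last by prove_linear.
pose g (a : H) (f : dual (F X)) := a ⊗ s (coef x f).
have g_bil : bilinear_map g by rewrite /g; prove_linear.
rewrite -[RHS](tsum_coact_dual psi g_bil) (tsum_tmap _ _ _ g_bil) tsum_bind;
  last by rewrite /g; prove_linear.
by apply: eq_tsum => q e; rewrite /g sE iso_funK.
Qed.

Lemma s_eps h : eps (s h) = eps h.
Proof.
move: h; apply: (coend_ext_lin H_coend); [by prove_linear | by prove_linear |] => X x psi.
by rewrite sE !(coef_eps H_coend) /= iso_invK.
Qed.

(** On coefficients, convolving with beta amounts to evaluating the comodule legs
    of x and psi against each other. *)
Lemma sweedler_beta X (x : F X) (psi : linear_form (F X)) (W : lmodType k) (g : H -> H -> W) :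
  bilinear_map g ->
  \sw_(h1, r <- coef x psi) \sw_(h2, h3 <- r) (beta h2 : k) *: g h1 (s h3) =
  \tsum_(a, x0 <- δ X x) \tsum_(b, f0 <- coact_dual X psi) (ev_star nu X (x0 ⊗ f0) : k) *: g a b.
Proof.
move=> [gl gr].
rewrite (tsum_Delta_coef H_coend); last by prove_linear.
rewrite tsum_coact; last by prove_linear.
apply: eq_tsum => p y; rewrite (tsum_Delta_coef H_coend); last by prove_linear.
rewrite tsum_coact_dual; last by prove_linear.
by apply: eq_tsum => q z; rewrite betaE.
Qed.

(** On coefficients, convolving with alpha amounts to inserting db^*(1) between x
    and psi. *)
Lemma sweedler_alpha X (x : F X) (psi : linear_form (F X)) (W : lmodType k) (g : H -> H -> W) :
  bilinear_map g ->
  \sw_(h1, r <- coef x psi) \sw_(h2, h3 <- r) (alpha h2 : k) *: g h1 h3 =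
  \tsum_(f, v <- db_star nu X 1) g (coef x f) (coef v psi).
Proof.
move=> [gl gr].
rewrite (tsum_Delta_coef H_coend); last by prove_linear.
under eq_tsum do (rewrite (tsum_Delta_coef H_coend); last by prove_linear).
by rewrite (@alpha_sum _ _ (fun f v => g (coef x f) (coef v psi))) //; prove_linear.
Qed.

(** This is the colinearity of ev^* at x ⊗ psi. *)
Lemma s_beta h :
  (\sw_(h1, r <- h) \sw_(h2, h3 <- r) (beta h2 : k) *: (h1 *h s h3)) = (beta h : k) *: cq_one H.
Proof.
move: h; apply: (coend_ext_lin H_coend); [by prove_linear | by prove_linear |] => X x psi.
rewrite (@sweedler_beta _ _ _ _ (@cq_mul k H)); last by prove_linear.
have := ev_star_comodule_map H_coend nu (x ⊗ psi).
rewrite tensor_coact_tens.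
pose h (t : H ⨂ k^o) := \tsum_(a, c <- t) (c : k) *: a.
have h_lin : linear h by rewrite /h; prove_linear.
have h_tens a c : h (a ⊗ c) = (c : k) *: a by rewrite /h tliftE //; prove_linear.
move=> /(congr1 h); rewrite h_tens betaE => ->.
rewrite tsum_tsum; last by prove_linear.
rewrite (tsum_lin _ _ h_lin); apply: eq_tsum => a x0.
rewrite tsum_bind; last by prove_linear.
by rewrite (tsum_lin _ _ h_lin); apply: eq_tsum => b f0; rewrite h_tens.
Qed.

(** This is the colinearity of db^*, paired with x and psi. *)
Lemma s_alpha h :
  (\sw_(h1, r <- h) \sw_(h2, h3 <- r) (alpha h2 : k) *: (s h1 *h h3)) = (alpha h : k) *: cq_one H.
Proof.
move: h; apply: (coend_ext_lin H_coend); [by prove_linear | by prove_linear |] => X x psi.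
rewrite (@sweedler_alpha _ _ _ _ (fun a b => s a *h b)); last by prove_linear.
have := db_star_comodule_map H_coend nu X 1.
rewrite /unit_coact tliftE; last by prove_linear.
pose h (t : H ⨂ (dual (F X) ⨂ F X)) :=
  \tsum_(a, t' <- t) \tsum_(f, v <- t') ((f : linear_form (F X)) x * psi v : k) *: a.
have h_lin : linear h by rewrite /h; prove_linear.
have h_tens a t : h (a ⊗ t) = \tsum_(f, v <- t) ((f : linear_form (F X)) x * psi v : k) *: a.
  by rewrite /h tliftE //; prove_linear.
move=> /(congr1 h); rewrite [X in _ = X]h_tens tsum_scalel -alphaE => <-.
rewrite (tsum_lin _ _ h_lin); apply: eq_tsum => f v.
rewrite (tsum_lin _ _ h_lin) -(@tsum_coact_dual_form _ f x _ (fun a => a *h _));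
  last by prove_linear.
apply: eq_tsum => a f0; rewrite (tsum_lin _ _ h_lin).
rewrite -(@tsum_coact_form _ _ _ _ _ _ v _ (fun b => a *h b)); last by prove_linear.
rewrite -tsumZ; apply: eq_tsum => b v0.
rewrite h_tens tliftE; last by prove_linear.
by rewrite scalerA.
Qed.

(** On the coefficient of x and psi the left-hand side is psi applied to the zigzag
    of the comodule F X at x. *)
Lemma s_omega h :
  (\sw_(h1, r <- h) \sw_(h2, r' <- r) \sw_(h3, r'' <- r') \sw_(h4, h5 <- r'')
     (omega h1 ((beta h2 * alpha h4 : k) *: s h3) h5 : k^o)) = eps h.
Proof.
move: h; apply: (coend_ext_lin H_coend); [by prove_linear | by prove_linear |] => X x psi.
rewrite (coef_eps H_coend) -[in RHS](ev_db_star F_neutral H_coend nu x)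
  (tsum_lin _ _ (linearP psi)).
have inner (a b : H) (e : k) (v : F X) :
    psi (\tsum_(c, v0 <- δ X v) (omega a b c * e : k) *: v0) = e *: (omega a b (coef v psi) : k^o).
  rewrite (tsum_lin _ _ (linearP psi)).
  rewrite -(@tsum_coact_form _ _ _ _ _ _ v k^o (omega a b)); last by prove_linear.
  rewrite -tsumZ; apply: eq_tsum => c v0; rewrite linearZ /= scalerA.
  by rewrite /GRing.scale /= -mulrA mulrC.
under [RHS]eq_tsum => f v.
  rewrite (tsum_lin _ _ (linearP psi)); under eq_tsum => a x0.
    rewrite (tsum_lin _ _ (linearP psi)); under eq_tsum do rewrite inner.
    over.
  rewrite -(@sweedler_beta _ x f k^o (fun a b => omega a b (coef v psi))); last by prove_linear.
  rewrite (tsum_Delta_coef H_coend); last by prove_linear.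
  under eq_tsum => p y do (rewrite (tsum_Delta_coef H_coend); last by prove_linear).
  over.
(* The sum over db^*(1) is moved inside the sums that come from x and beta, and
   is then absorbed by alpha. *)
rewrite tsum_exchange (tsum_Delta_coef H_coend); last by prove_linear.
apply: eq_tsum => p y; rewrite tsum_exchange (tsum_Delta_coef H_coend); last by prove_linear.
apply: eq_tsum => q z; rewrite tsumZ.
rewrite -(@sweedler_alpha _ z psi k^o (fun a b => omega (coef x p) (s a) b)); last by prove_linear.
rewrite -tsumZ; apply: eq_tsum => h3 r; rewrite -tsumZ; apply: eq_tsum => h4 h5.
by rewrite scalerA /omega tensZr tensZl linearZ.
Qed.

(** On the coefficient of x and psi the left-hand side is the other zigzag of the comodule
    F X, at psi, evaluated at x. *)
Lemma s_omega_inv h :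
  (\sw_(h1, r <- h) \sw_(h2, r' <- r) \sw_(h3, r'' <- r') \sw_(h4, h5 <- r'')
     (omega_inv (s h1) ((alpha h2 * beta h4 : k) *: h3) (s h5) : k^o)) = eps h.
Proof.
move: h; apply: (coend_ext_lin H_coend); [by prove_linear | by prove_linear |] => X x psi.
pose ev_x (f : dual (F X)) : k^o := (f : linear_form (F X)) x.
have ev_lin : linear ev_x by rewrite /ev_x; prove_linear.
rewrite (coef_eps H_coend) -[RHS]/(ev_x psi) -[in RHS](db_ev_star F_neutral H_coend nu psi)
  (tsum_lin _ _ ev_lin).
(* beta produces G, the pairing of v with psi through ev^*; alpha then inserts
   db^*(1) between x and G. *)
pose G (a : H) (v : F X) : k^o := \tsum_(b, v0 <- δ X v) \tsum_(c, g0 <- coact_dual X psi)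
  (ev_star nu X (v0 ⊗ g0) : k) *: (omega_inv a b c : k^o).
transitivity (\tsum_(f, v <- db_star nu X 1) G (s (coef x f)) v).
  rewrite -(@alpha_sum X k^o (fun f v => G (s (coef x f)) v)); last by rewrite /G; prove_linear.
  rewrite (tsum_Delta_coef H_coend); last by prove_linear.
  apply: eq_tsum => p y; rewrite (tsum_Delta_coef H_coend); last by prove_linear.
  apply: eq_tsum => q z; rewrite /G -(@sweedler_beta _ z psi k^o (omega_inv (s (coef x p))));
    last by prove_linear.
  rewrite -tsumZ; apply: eq_tsum => h3 r; rewrite -tsumZ; apply: eq_tsum => h4 h5.
  by rewrite scalerA /omega_inv tensZr tensZl linearZ.
apply: eq_tsum => f v; rewrite -(@tsum_coact_dual_form X f x k^o (fun a => G a v));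
  last by rewrite /G; prove_linear.
rewrite (tsum_lin _ _ ev_lin); apply: eq_tsum => a f0.
rewrite /G -tsumZ (tsum_lin _ _ ev_lin); apply: eq_tsum => b v0.
rewrite -tsumZ (tsum_lin _ _ ev_lin); apply: eq_tsum => c g0.
rewrite (scalable_linear ev_lin) /= scalerA.
by rewrite /ev_x /GRing.scale /= -mulrA mulrC [X in X * _]mulrC.
Qed.

Lemma s_alpha_beta_antipode : coquasi_antipode s alpha beta.
Proof.
split.
- exact: s_Delta.
- exact: s_eps.
- exact: s_beta.
- exact: s_alpha.
- exact: s_omega.
- exact: s_omega_inv.
Qed.

Lemma alpha_equation_holds : alpha_equation nu i alpha.
Proof.
move=> X x; rewrite (tmap_coact i alpha).
have -> : tassoc_inv (x ⊗ db_star nu X 1) = \tsum_(f, v <- db_star nu X 1) x ⊗ f ⊗ v.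
  by rewrite /tassoc_inv tliftE //; prove_linear.
rewrite tmap_tsum_tens.
under eq_tsum => q e.
  rewrite alphaE -[_ ⊗ e]/((fun c : k^o => c ⊗ e) _) tsum_lin; last by prove_linear.
  under eq_tsum => f v.
    rewrite mulrC -[_ * _]/(q v *: ((f : linear_form (F X)) x : k^o)) tensZl.
    over.
  over.
rewrite tsum_exchange; apply: eq_tsum => f v.
rewrite (@dual_basis_vec _ _ (fob_fgp F X) _ (tens (f x : k^o))); last by prove_linear.
by rewrite /= /ev_std tliftE //; prove_linear.
Qed.

Lemma beta_equation_holds : beta_equation nu i beta.
Proof.
move=> X x; rewrite (tmap_coact i beta) db_std_1.
have -> : tassoc_inv (x ⊗ DB X) = \tsum_(f, v <- DB X) x ⊗ f ⊗ v.
  by rewrite /tassoc_inv tliftE //; prove_linear.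
by rewrite tmap_tsum_tens; apply: eq_tsum => q e; rewrite betaE.
Qed.

Lemma antipode_equation_holds : antipode_equation nu i s.
Proof.
move=> X x; rewrite (tmap_coact i s) db_std_1; apply: eq_tsum => f e.
rewrite -(@tsum_coact_dual_form X f x _ (fun a => a ⊗ e)); last by prove_linear.
apply: eq_tsum => a f0; rewrite -tensZr /= /ev_std tliftE //; prove_linear.
Qed.

End AntipodeAxioms.

Theorem mainTheorem4 (k : comPzRingType) (C : monoidal)
    (C_small : essentially_small C) (D : right_duals C)
    (F : quasi_monoidal_functor k C) (F_neutral : neutral F)
    (H : coquasi_bialgebra k)
    (i : forall X : C, {linear F X ⨂ dual (F X) -> H})
    (H_coend : coendomorphism_bialgebra i)
    (nu : forall X : C, lin_iso (F (rdual D X)) (dual (F X)))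
    (nu_natural : dual_natural nu) :
  (forall X : C,
     comod_right_dual (@coact k C F H i X : {linear F X -> H ⨂ F X}) (coact_dual nu i X)
       (ev_star nu X) (db_star nu X)) /\
  exists (s : {linear H -> H}) (alpha beta : linear_form H),
    [/\ alpha_equation nu i alpha /\
          (forall alpha' : linear_form H, alpha_equation nu i alpha' -> alpha' = alpha),
        beta_equation nu i beta /\
          (forall beta' : linear_form H, beta_equation nu i beta' -> beta' = beta),
        antipode_equation nu i s /\
          (forall s' : {linear H -> H}, antipode_equation nu i s' -> s' =1 s),
        coquasi_antipode s alpha beta /\ coquasi_Hopf H &
        forall X : C,
          [/\ forall f : linear_form (F X),
                coact_dual nu i X f =
                \tsum_(e', e <- db_std (F X) 1) \tsum_(a, e0 <- coact i e)
                  ((f e0 : k) *: s a) ⊗ e',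
              db_star nu X 1 =
                \tsum_(e', e <- db_std (F X) 1) \tsum_(a, e0 <- coact i e)
                  e' ⊗ ((alpha a : k) *: e0) &
              forall (x : F X) (f : linear_form (F X)),
                ev_star nu X (x ⊗ f) =
                \tsum_(a, x0 <- coact i x) (beta a * f x0 : k^o)]].
Proof.
split; first exact: comod_right_dual_star.
have [s sE] := antipode_exists H_coend nu_natural.
have [alpha alphaE] := alpha_exists H_coend nu_natural.
have [beta betaE] := beta_exists H_coend nu_natural.
have aeq : alpha_equation nu i alpha := alpha_equation_holds alphaE.
have beq : beta_equation nu i beta := beta_equation_holds betaE.
have seq := antipode_equation_holds sE.
have s_antipode := s_alpha_beta_antipode F_neutral H_coend sE alphaE betaE.
exists s, alpha, beta; split.
- split=> // alpha' h; apply: dual_ext.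
  by apply: (coact_separates H_coend) => X x; rewrite aeq h.
- split=> // beta' h; apply: dual_ext.
  by apply: (coact_separates H_coend) => X x; rewrite beq h.
- by split=> // s' h; apply: (coact_separates H_coend) => X x; rewrite seq h.
- by split=> //; exists s, alpha, beta.
move=> X; rewrite db_std_1; split.
- move=> f; rewrite (coact_dualE sE); apply: eq_tsum => q e.
  rewrite -(@tsum_coact_form _ _ _ _ _ _ e _ (fun a => s a ⊗ q)); last by prove_linear.
  by apply: eq_tsum => a e0; rewrite tensZl.
- rewrite -[LHS]tsum_tens -(alpha_sum alphaE); last exact: tens_bilinear.
  apply: eq_tsum => q e; rewrite tsum_coact; last by prove_linear.
  by apply: eq_tsum => q' e'; rewrite tensZr.
- move=> x f; rewrite -betaE -(@tsum_coact_form _ _ _ _ _ _ x k^o beta); last by prove_linear.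
  by apply: eq_tsum => a x0; rewrite [LHS]mulrC.
Qed.
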